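(* Let $\mathcal{M}$ be a regular structure with countably infinite universe $M$, and let $P_{\rm Ehr}\subseteq B(\mathcal{M})$ be the family of Ehrenfeucht structures in $B(\mathcal{M})$. Then: $P_{\rm Ehr}\ne\emptyset$; neither the least nor the greatest element of $\mathcal{B}(\mathcal{M})$ belongs to $P_{\rm Ehr}$; $P_{\rm Ehr}$ is closed under permutations; $P_{\rm Ehr}$ can fail under restrictions and expansions (there are $\mathcal{N}\in P_{\rm Ehr}$ having a restriction in $B(\mathcal{M})$ not in $P_{\rm Ehr}$, and $\mathcal{N}'\in P_{\rm Ehr}$ having an expansion in $B(\mathcal{M})$ not in $P_{\rm Ehr}$); there is an infinite chain $\mathcal{N}_0<\mathcal{N}_1<\mathcal{N}_2<\cdots$ of successive expansions in $B(\mathcal{M})$ whose members alternate between belonging to $P_{\rm Ehr}$ and not belonging to it; and there are atoms of $\mathcal{B}(\mathcal{M})$ (structures with exactly one signature symbol) belonging to $P_{\rm Ehr}$.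
   Context: A structure is regular if it is relational and no two distinct signature symbols have the same interpretation. For a regular $\mathcal{M}$ with universe $M$, $\overline{\mathcal{M}}$ is a maximal regular expansion of $\mathcal{M}$ on $M$ (every finitary relation on $M$ named by exactly one symbol), $B(\mathcal{M})$ is the set of restrictions of $\overline{\mathcal{M}}$ to subsignatures (universe $M$), and $\mathcal{B}(\mathcal{M})$ is the Boolean algebra on it given by union/intersection of signatures, with greatest element $\overline{\mathcal{M}}$, least element the structure with empty signature, order $\mathcal{N}_1\le\mathcal{N}_2$ iff $\mathcal{N}_2$ expands $\mathcal{N}_1$. A structure is Ehrenfeucht if its complete theory has finitely many but more than one countable models up to isomorphism. For a permutation $f$ of $M$ and $\mathcal{N}\in B(\mathcal{M})$, $f(\mathcal{N})$ is the structure in $B(\mathcal{M})$ whose signature relations are the images $f(Q)$ of those of $\mathcal{N}$; $P$ is closed under permutations if $f(\mathcal{N})\in P$ for all $f$ and all $\mathcal{N}\in P$. *)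

(* Defs.v *)
From HB Require Import structures.
From mathcomp Require Import all_boot all_order.
From mathcomp Require Import all_classical.

Set Implicit Arguments.
Unset Strict Implicit.
Unset Printing Implicit Defensive.

Local Open Scope classical_set_scope.

(* Relational signatures; arity 0 is allowed. *)
Record signature := Signature { symbol :> Type; arity : symbol -> nat }.
Arguments arity {_} _.

Definition structure (L : signature) (A : Type) : Type :=
  forall s : L, set ('I_(arity s) -> A).

(* A finitary relation carries its arity, so that empty relations of distinct *)
(* arities are distinct.                                                      *)
Definition relation (A : Type) : Type := {n : nat & set ('I_n -> A)}.

Definition interp (L : signature) (A : Type) (M : structure L A) (s : L) :
    relation A :=
  existT (fun n => set ('I_n -> A)) (arity s) (M s).

Definition regular (L : signature) (A : Type) (M : structure L A) : Prop :=
  injective (interp M).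

(* [N] expands [M]; the signature of [M] is identified with its image under   *)
(* [e]. Equality of interpretations includes equality of arities.             *)
Definition expansion (L L' : signature) (A : Type)
    (M : structure L A) (N : structure L' A) : Prop :=
  exists e : L -> L',
    injective e /\ forall s : L, interp N (e s) = interp M s.

Definition maximal_regular_expansion (L L' : signature) (A : Type)
    (M : structure L A) (N : structure L' A) : Prop :=
  [/\ expansion M N, regular N
    & forall Q : relation A, exists! s : L', interp N s = Q].

(* First-order formulas with equality whose free variables are indexed by     *)
(* ['I_n]. The quantifier binds the variable [ord0]; the other variables are  *)
(* shifted by [lift ord0].                                                    *)
Inductive formula (L : signature) : nat -> Type :=
| Fbot n : formula L n
| Feq n (i j : 'I_n) : formula L n
| Frel n (s : L) (v : 'I_(arity s) -> 'I_n) : formula L n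
| Fimp n (p q : formula L n) : formula L n
| Fall n (p : formula L n.+1) : formula L n.

Definition extend (A : Type) (n : nat) (a : A) (v : 'I_n -> A) : 'I_n.+1 -> A :=
  fun i => if unlift ord0 i is Some j then v j else a.

Fixpoint satisfies (L : signature) (A : Type) (M : structure L A) (n : nat)
    (p : formula L n) : ('I_n -> A) -> Prop :=
  match p in formula _ n return ('I_n -> A) -> Prop with
  | Fbot _ => fun _ => False
  | Feq _ i j => fun v => v i = v j
  | Frel _ s w => fun v => M s (v \o w)
  | Fimp _ p q => fun v => satisfies M p v -> satisfies M q v
  | Fall _ p => fun v => forall a : A, satisfies M p (extend a v)
  end.

Definition sentence (L : signature) : Type := formula L 0.

Definition models (L : signature) (A : Type) (M : structure L A)
    (p : sentence L) : Prop :=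
  forall v : 'I_0 -> A, satisfies M p v.

Definition theory (L : signature) (A : Type) (M : structure L A) :
    set (sentence L) :=
  [set p | models M p].

Definition isomorphic (L : signature) (A B : Type)
    (M : structure L A) (N : structure L B) : Prop :=
  exists f : A -> B, bijective f /\
    forall (s : L) (v : 'I_(arity s) -> A), M s v <-> N s (f \o v).

(* Nonemptiness of the universe is imposed as usual in first-order logic.     *)
Record countable_model (L : signature) (T : set (sentence L)) := CountableModel {
  universe : Type;
  struct :> structure L universe;
  universe_neq0 : inhabited universe;
  universe_countable : countable [set: universe];
  struct_models : T `<=` theory struct }.
Arguments struct {L T} c s _.

Definition Ehrenfeucht (L : signature) (A : Type) (M : structure L A) : Prop :=
  exists2 k : nat, 1 < k &
  exists F : 'I_k -> countable_model (theory M),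
    (forall i j : 'I_k, isomorphic (F i) (F j) -> i = j) /\
    (forall N : countable_model (theory M), exists i : 'I_k, isomorphic N (F i)).

Definition subsignature (L : signature) (S : set L) : signature :=
  @Signature {s : L | S s} (fun s => arity (proj1_sig s)).

Definition restriction (L : signature) (A : Type) (M : structure L A)
    (S : set L) : structure (subsignature S) A :=
  fun s => M (proj1_sig s).
Arguments restriction {L A} M S _ _.

(* Elements of the Boolean algebra of restrictions of [N] to subsignatures,   *)
(* for [N] regular, are represented by the subsignatures themselves: the      *)
(* element [S] is the structure [restriction N S]. The Boolean operations,    *)
(* [\bot], [\top] and the order are the canonical ones on [set L]; see        *)
(* [le_restriction] for the order.                                            *)
Definition BA (L : signature) (A : Type) (N : structure L A) : Type := set L.

Lemma le_restriction (L : signature) (A : Type) (N : structure L A)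
    (S1 S2 : BA N) : regular N ->
  (S1 <= S2)%O <-> expansion (restriction N S1) (restriction N S2).
Proof.
move=> regN; split.
  move=> /subsetPset S12.
  exists (fun s : subsignature S1 => exist S2 (proj1_sig s) (S12 _ (proj2_sig s))).
  split => // -[s Ps] [t Pt] [est]; subst t.
  by rewrite (Prop_irrelevance Ps Pt).
move=> [e [_ he]]; apply/subsetPset => s Ss.
have es : proj1_sig (e (exist _ s Ss)) = s by apply: regN; exact: he.
by rewrite -es; exact: proj2_sig.
Qed.

Lemma maximal_regular_expansion_exists (L : signature) (A : Type)
    (M : structure L A) : regular M ->
  exists (L' : signature) (N : structure L' A), maximal_regular_expansion M N.
Proof.
move=> regM.
pose L' := @Signature (relation A) (@projT1 _ _).
pose N : structure L' A := fun s => projT2 s.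
have NE s : interp N s = s by case: s.
exists L', N; split; first by exists (interp M).
  by move=> s t; rewrite !NE.
by move=> Q; exists Q; split=> [|s <-]; rewrite NE.
Qed.

Definition image_relation (A : Type) (f : A -> A) (Q : relation A) : relation A :=
  existT (fun n => set ('I_n -> A)) (projT1 Q) [set f \o v | v in projT2 Q].

Definition permute (L : signature) (A : Type) (N : structure L A)
    (f : A -> A) (S : BA N) : BA N :=
  [set t : L | exists2 s : L, S s & interp N t = image_relation f (interp N s)].
Arguments permute {L A N} f S _.

Definition closed_under_permutations (L : signature) (A : Type)
    (N : structure L A) (P : set (BA N)) : Prop :=
  forall f : A -> A, bijective f -> forall S : BA N, P S -> P (permute f S).

Definition atom (d : Order.disp_t) (T : bPOrderType d) (x : T) : Prop :=
  x <> \bot%O /\ forall y : T, (y <= x)%O -> y = \bot%O \/ y = x.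

Definition PEhr (L : signature) (A : Type) (N : structure L A) : set (BA N) :=
  [set S | Ehrenfeucht (restriction N S)].
Arguments PEhr {L A} N _.

(* Main.v *)
Require Import Defs.
From HB Require Import structures.
From mathcomp Require Import all_boot all_order all_algebra.
From mathcomp Require Import all_classical.

Set Implicit Arguments.
Unset Strict Implicit.
Unset Printing Implicit Defensive.

Import Order.TTheory GRing.Theory Num.Theory.

Local Open Scope classical_set_scope.
Local Open Scope card_scope.

(** Every relation used lives on three disjoint parts of [A]: a rigid part [D]
    on which all relations are named, a part [P] carrying a total preorder, and
    a pure set [R].

    If all relations on [D] are named, then [D] does not grow in a countable
    model: a nonstandard element would have [2 ^ nat] distinct images under the
    named functions. Hence without [P] there is exactly one countable model, and
    such structures (among them the least and the greatest element) are not
    Ehrenfeucht.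

    The preorder on [P] is chosen so that the class sizes are nondecreasing and
    so that for every [n] the classes of size [n + 1] form a dense order without
    endpoints. By Cantor's theorem the countable models are then determined by
    the set of infinite classes: it is empty, or has a least element, or is
    nonempty without least element. An Ehrenfeucht-Fraisse argument shows that
    the third possibility does occur, because a sentence of quantifier rank [Q]
    does not distinguish classes with more than [Q] elements. So there are two
    or three countable models, with a single binary symbol.

    Splitting [A] into infinitely many infinite pieces, one alternately adds the
    preorder on the next piece and then all relations on that piece. *)

(** * Cardinality *)

(** The model is Ehrenfeucht's theory of a dense order with constants [c_0 < c_1 < ...], whose three
    countable models differ in whether the sequence is unbounded, has a supremum, or is bounded
    without one. Class sizes replace the constants here: lying above all [c_n] becomes lying in an
    infinite class. One binary symbol then suffices, which is what an atom requires. The obstacle is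
    that a signature naming all relations on an infinite [D] is uncountable, so compactness and
    Loewenheim-Skolem do not yield a countable nonstandard model. It is therefore written down
    explicitly, with the same rigid part, and compared with the given structure one sentence at a
    time. A model with a least infinite class is never built: an upper bound of three and two
    non-isomorphic models are enough. Making a piece rigid destroys the Ehrenfeucht property of its
    preorder, since no new class can appear on a part that cannot grow. *)

Lemma card_le_of_inj (T U : Type) (A : set T) (B : set U) (f : T -> U) :
  (forall x, A x -> B (f x)) ->
  (forall x y, A x -> A y -> f x = f y -> x = y) -> A #<= B.
Proof.
move=> fAB finj.
have fI : {in A &, injective f} by move=> x y /set_mem Ax /set_mem Ay; exact: finj.
rewrite -(card_le_eql (inj_card_eq fI)); apply: subset_card_le.
by move=> _ [x Ax <-]; exact: fAB.
Qed.

Lemma card_le_ex_inj (T U : Type) (A : set T) (B : set U) :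
  inhabited U -> A #<= B ->
  exists f : T -> U, (forall x, A x -> B (f x)) /\
    (forall x y, A x -> A y -> f x = f y -> x = y).
Proof.
move=> [u0] /card_leP[f].
exists (fun x => if pselect (A x) is left Ax then val (f (SigSub (mem_set Ax))) else u0).
split=> [x Ax|x y Ax Ay].
  by case: pselect => // Ax'; exact: set_mem (valP _).
case: pselect => // Ax'; case: pselect => // Ay' /val_inj.
by move=> e; case: (@inj _ _ _ f _ _ (in_setT _) (in_setT _) e).
Qed.

Lemma card_eq_of_bij (T U : Type) (A : set T) (B : set U) (f : T -> U) :
  (forall x, A x -> B (f x)) ->
  (forall x y, A x -> A y -> f x = f y -> x = y) ->
  (forall y, B y -> exists2 x, A x & f x = y) -> A #= B.
Proof.
move=> fAB finj fsurj.
have fI : {in A &, injective f} by move=> x y /set_mem Ax /set_mem Ay; exact: finj.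
rewrite card_eq_sym.
suff -> : B = f @` A by exact: inj_card_eq.
apply/seteqP; split=> [y /fsurj[x Ax <-]|_ [x Ax <-]]; first by exists x.
exact: fAB.
Qed.

Lemma card_eq_ex_bij (T U : Type) (A : set T) (B : set U) :
  inhabited U -> A #= B ->
  exists f : T -> U, [/\ forall x, A x -> B (f x),
    (forall x y, A x -> A y -> f x = f y -> x = y) &
    forall y, B y -> exists2 x, A x & f x = y].
Proof.
move=> [u0] /card_bijP[f [g fK gK]].
exists (fun x => if pselect (A x) is left Ax then val (f (SigSub (mem_set Ax))) else u0).
split=> [x Ax|x y Ax Ay|y By].
- by case: pselect => // Ax'; exact: set_mem (valP _).
- case: pselect => // Ax'; case: pselect => // Ay' /val_inj /(can_inj fK).
  by case.
- pose x := g (SigSub (mem_set By)).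
  have Ax : A (val x) := set_mem (valP x).
  exists (val x) => //; case: pselect => // Ax'.
  rewrite (_ : SigSub _ = x); first by rewrite /x gK.
  exact: val_inj.
Qed.

(** This recursion on [k] turns a lower bound on a cardinality into a first-order formula; see
    [definable_card_ge]. *)
Lemma card_geSP (U : Type) (Y : set U) (k : nat) :
  `I_k.+1 #<= Y <-> exists2 b, Y b & `I_k #<= [set u | Y u /\ u <> b].
Proof.
split=> [kY|[b Yb kY]].
  have [inhU|noU] := pselect (inhabited U); last first.
    have Y0 : Y = set0 by rewrite -subset0 => u _; exact: noU (inhabits u).
    by move: kY; rewrite Y0 => /card_le0P e; have : `I_k.+1 0%N by []; rewrite e.
  have [f [fY finj]] := card_le_ex_inj inhU kY.
  exists (f k); first by apply: fY => /=.
  apply: (@card_le_of_inj _ _ _ _ f) => [x /= xk|x y /= xk yk].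
    split; first by apply: fY; exact: ltnW.
    by move=> /finj e; move: (xk); rewrite e /= ?ltnn // ltnW.
  by apply: finj; exact: ltnW.
have [f [fY finj]] := card_le_ex_inj (inhabits b) kY.
apply: (@card_le_of_inj _ _ _ _ (fun i => if i == k then b else f i)) => /= [x|x y].
  rewrite ltnS leq_eqVlt; case: eqVneq => //= _ xk; exact: (fY _ xk).1.
rewrite !ltnS => xk yk.
have ltk z : (z <= k)%N -> z != k -> (z < k)%N by rewrite ltn_neqAle => -> ->.
case: eqVneq => [->|/(ltk _ xk) {}xk]; case: eqVneq => [->|/(ltk _ yk) {}yk] //.
- by move=> e; have := (fY _ yk).2; rewrite -e.
- by move=> e; have := (fY _ xk).2; rewrite -e.
- exact: finj.
Qed.

Lemma infinite_card_ge (U : Type) (Y : set U) :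
  (forall k, `I_k #<= Y) -> infinite_set Y.
Proof.
move=> kY /finite_setP[n Yn]; have := kY n.+1.
by rewrite (card_le_eqr Yn) card_le_II ltnn.
Qed.

Lemma card_eq_II_le (U : Type) (Y : set U) (n : nat) :
  Y #= `I_n <-> `I_n #<= Y /\ ~ (`I_n.+1 #<= Y).
Proof.
split=> [Yn|[nY nSY]].
  by rewrite !(card_le_eqr Yn) !card_le_II leqnn ltnn.
have [/finite_setP[m Ym]|Yinf] := pselect (finite_set Y); last first.
  case: nSY; move/infiniteP: Yinf; apply: card_le_trans; exact: card_leT.
move: nY nSY; rewrite !(card_le_eqr Ym) !card_le_II => nm /negP.
rewrite -leqNgt => mn; suff -> : n = m by [].
by apply/eqP; rewrite eqn_leq nm.
Qed.

(** Any element may be removed in place of the witness [b'] of [card_geSP]: send [b] to [b'] and fix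
    all the rest. *)
Lemma card_geS_rem (U : Type) (Y : set U) (b : U) (k : nat) : Y b ->
  `I_k.+1 #<= Y <-> `I_k #<= [set u | Y u /\ u <> b].
Proof.
move=> Yb; split=> [/card_geSP[b' Yb' kY]|kY]; last by apply/card_geSP; exists b.
apply: card_le_trans kY _.
apply: (@card_le_of_inj _ _ _ _ (fun u => if pselect (u = b) then b' else u)) => /=.
  by move=> u [Yu ub']; case: pselect => // ub; split=> //= e; apply: ub'; rewrite ub.
move=> u v [Yu ub] [Yv vb].
by case: pselect => /= eu; case: pselect => /= ev //; congruence.
Qed.

Lemma card_eqS_rem (U : Type) (Y : set U) (b : U) (n : nat) : Y b ->
  Y #= `I_n.+1 <-> [set u | Y u /\ u <> b] #= `I_n.
Proof.
move=> Yb; have h := fun k => card_geS_rem k Yb.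
split=> /card_eq_II_le[h1 h2]; apply/card_eq_II_le; split.
- exact/h.
- by move=> /h.
- exact/h.
- by move=> /h.
Qed.

(** * Uniformly definable predicates *)

Lemma extend0 (A : Type) n (a : A) (v : 'I_n -> A) : extend a v ord0 = a.
Proof. by rewrite /extend unlift_none. Qed.

Lemma extendS (A : Type) n (a : A) (v : 'I_n -> A) i :
  extend a v (lift ord0 i) = v i.
Proof. by rewrite /extend liftK. Qed.

Lemma extend_eta (A : Type) n (v : 'I_n.+1 -> A) :
  extend (v ord0) (v \o lift ord0) = v.
Proof.
by apply/funext => i; case: (unliftP ord0 i) => [j|] ->; rewrite ?extendS ?extend0.
Qed.

Lemma extend_lift (A : Type) n (a : A) (v : 'I_n -> A) :
  extend a v \o lift ord0 = v.
Proof. by apply/funext => i; rewrite /= extendS. Qed.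

Lemma fun_ord0 (A : Type) (v w : 'I_0 -> A) : v = w.
Proof. by apply/funext => -[]. Qed.

Section Definable.
Variable L : signature.

(** The predicate is given on all structures at once, so that a single formula expresses it both in
    [M] and in the models of its theory. *)
Definition upred n := forall U : Type, structure L U -> ('I_n -> U) -> Prop.

Definition definable n (P : upred n) : Prop :=
  exists p : formula L n, forall U (N : structure L U) v,
    satisfies N p v <-> P U N v.

Lemma definable_ext n (P Q : upred n) : definable P ->
  (forall U (N : structure L U) v, P U N v <-> Q U N v) -> definable Q.
Proof. by move=> [p pP] PQ; exists p => U N v; rewrite pP. Qed.

Lemma definable_false n : definable (fun U (N : structure L U) (v : 'I_n -> U) => False).
Proof. by exists (Fbot L n). Qed.

Lemma definable_eq n (i j : 'I_n) :
  definable (fun U (N : structure L U) (v : 'I_n -> U) => v i = v j).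
Proof. by exists (Feq L i j). Qed.

Lemma definable_rel n (s : L) (w : 'I_(arity s) -> 'I_n) :
  definable (fun U (N : structure L U) (v : 'I_n -> U) => N s (v \o w)).
Proof. by exists (Frel w). Qed.

Lemma definable_imp n (P Q : upred n) : definable P -> definable Q ->
  definable (fun U N v => P U N v -> Q U N v).
Proof.
move=> [p pP] [q qQ]; exists (Fimp p q) => U N v /=.
by rewrite pP qQ.
Qed.

Lemma definable_all n (P : forall U : Type, structure L U -> U -> ('I_n -> U) -> Prop) :
  definable (fun U N (v : 'I_n.+1 -> U) => P U N (v ord0) (v \o lift ord0)) ->
  definable (fun U N v => forall a, P U N a v).
Proof.
move=> [p pP]; exists (Fall p) => U N v /=.
split=> h a; first by have := (pP _ _ _).1 (h a); rewrite extend0 extend_lift.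
by apply/pP; rewrite extend0 extend_lift.
Qed.

Lemma definable_not n (P : upred n) : definable P ->
  definable (fun U N v => ~ P U N v).
Proof. by move=> dP; apply: definable_imp dP (definable_false n). Qed.

Lemma definable_and n (P Q : upred n) : definable P -> definable Q ->
  definable (fun U N v => P U N v /\ Q U N v).
Proof.
move=> dP dQ.
apply: (definable_ext (definable_not (definable_imp dP (definable_not dQ)))) => U N v.
split=> [h|[p q] /(_ p)]; last by apply.
by split; apply: contrapT => h'; apply: h.
Qed.

Lemma definable_or n (P Q : upred n) : definable P -> definable Q ->
  definable (fun U N v => P U N v \/ Q U N v).
Proof.
move=> dP dQ.
apply: (definable_ext (definable_imp (definable_not dP) dQ)) => U N v.
split=> [h|[p|q] //].
by have [p|np] := pselect (P U N v); [left|right; exact: h].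
Qed.

Lemma definable_ex n (P : forall U : Type, structure L U -> U -> ('I_n -> U) -> Prop) :
  definable (fun U N (v : 'I_n.+1 -> U) => P U N (v ord0) (v \o lift ord0)) ->
  definable (fun U N v => exists a, P U N a v).
Proof.
move=> dP.
have := definable_all (P := fun U N a v => ~ P U N a v) (definable_not dP).
move=> /definable_not dE; apply: (definable_ext dE) => U N v.
split=> [/existsNP[a /contrapT Pa]|[a Pa] /(_ a)]; by [exists a|].
Qed.

(** It supplies the weakening needed when a predicate is placed under one more quantifier. *)
Lemma definable_rename n m (r : 'I_n -> 'I_m) (P : upred n) : definable P ->
  definable (fun U N v => P U N (v \o r)).
Proof.
move=> [p pP].
suff [q qP] : definable (fun U N v => satisfies N p (v \o r)).
  by exists q => U N v; rewrite qP pP.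
elim: p m r {P pP} => {n} [n|n i j|n s w|n p IHp q IHq|n p IHp] m r /=.
- exact: definable_false.
- exact: definable_eq.
- exact: definable_rel.
- exact: definable_imp.
- apply: definable_all.
  apply: definable_ext (IHp _ (extend ord0 (lift ord0 \o r))) _ => U N v.
  suff -> : v \o extend ord0 (lift ord0 \o r) =
            extend (v ord0) ((v \o lift ord0) \o r) by [].
  apply/funext => i; case: (unliftP ord0 i) => [j|] -> /=; by rewrite ?extendS ?extend0.
Qed.

Lemma definable_card_ge k n
    (P : forall U : Type, structure L U -> U -> ('I_n -> U) -> Prop) :
  definable (fun U N (v : 'I_n.+1 -> U) => P U N (v ord0) (v \o lift ord0)) ->
  definable (fun U N v => `I_k #<= [set a | P U N a v]).
Proof.
elim: k n P => [|k IHk] n P dP.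
  apply: (definable_ext (definable_not (definable_false n))) => U N v.
  by rewrite II0; split=> // _ [].
pose Q U (N : structure L U) a' (v : 'I_n.+1 -> U) :=
  P U N a' (v \o lift ord0) /\ a' <> v ord0.
have dQ : definable (fun U N (v : 'I_n.+2 -> U) => Q U N (v ord0) (v \o lift ord0)).
  apply: definable_and; last by apply: definable_not; exact: definable_eq.
  (* Variable 0 is [a'] and variable 1 is [a]; the renaming keeps the former and skips the
     latter. *)
  apply: definable_ext (definable_rename (extend ord0 (lift ord0 \o lift ord0)) dP) _.
  move=> U N v /=; rewrite extend0.
  suff -> : v \o extend ord0 (lift ord0 \o lift ord0) \o lift ord0 =
    (v \o lift ord0) \o lift ord0 by [].
  by apply/funext => i /=; rewrite extendS.
apply: (definable_ext (definable_ex (P := fun U N a v => P U N a v /\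
   `I_k #<= [set a' | P U N a' v /\ a' <> a]) _)) => [|U N v].
  exact: definable_and dP (IHk _ _ dQ).
rewrite card_geSP; split=> [[b [Pb ?]]|[b Pb ?]]; by exists b.
Qed.

Lemma definable_all_ord n m (P : 'I_m -> upred n) :
  (forall i, definable (P i)) -> definable (fun U N v => forall i, P i U N v).
Proof.
elim: m P => [|m IHm] P dP.
  by apply: (definable_ext (definable_not (definable_false n))) => U N v; split=> // _ [].
apply: (definable_ext (definable_and (dP ord0) (IHm (fun i => P (lift ord0 i)) (fun i => dP _)))).
move=> U N v; split=> [[P0 PS] i|h]; last by split.
by case: (unliftP ord0 i) => [j|] ->.
Qed.

Lemma definable_all_tuple n (P : upred n) : definable P ->
  definable (fun U N (_ : 'I_0 -> U) => forall v, P U N v).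
Proof.
elim: n P => [|n IHn] P dP.
  by apply: (definable_ext dP) => U N v; split=> [h w|]; [rewrite (fun_ord0 w v)|apply].
pose Q : upred n := fun U N v => forall a, P U N (extend a v).
have dQ : definable Q.
  apply: (definable_all (P := fun U N a v => P U N (extend a v))).
  by apply: (definable_ext dP) => U N v; rewrite extend_eta.
apply: (definable_ext (IHn _ dQ)) => U N _; split=> [h v|h v a //].
by rewrite -(extend_eta v); exact: h.
Qed.

Definition definable_sentence (P : forall U : Type, structure L U -> Prop) : Prop :=
  definable (fun U N (_ : 'I_0 -> U) => P U N).

Lemma definable_transfer A (M : structure L A) U (N : structure L U)
    (P : forall U : Type, structure L U -> Prop) :
  theory M `<=` theory N -> definable_sentence P -> P A M -> P U N.
Proof.
move=> MN [p pP] PM.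
have v0 : 'I_0 -> U by case.
by apply/(pP _ N v0); apply: (MN p) => v; apply/pP.
Qed.

(** [None] stands for the empty relation, which a small signature may fail to name. Evaluation at a
    constant tuple makes sense for every arity and avoids a cast. *)
Definition orel1 U (N : structure L U) (s : option L) (a : U) : Prop :=
  if s is Some s then N s (fun=> a) else False.

(* The arity of [s] is expected to be 2, but only propositionally. *)
Definition orel2 U (N : structure L U) (s : option L) (a b : U) : Prop :=
  if s is Some s then N s (fun i => if val i == 0%N then a else b) else False.

Lemma definable_orel1 n s (i : 'I_n) :
  definable (fun U (N : structure L U) v => orel1 N s (v i)).
Proof.
case: s => [s|]; last exact: definable_false.
exact: (definable_rel (s := s) (fun=> i)).
Qed.

Lemma definable_orel2 n s (i j : 'I_n) :
  definable (fun U (N : structure L U) v => orel2 N s (v i) (v j)).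
Proof.
case: s => [s|]; last exact: definable_false.
apply: definable_ext (definable_rel (s := s) (fun k => if val k == 0%N then i else j)) _.
move=> U N v /=.
suff -> : v \o (fun k : 'I_(arity s) => if val k == 0%N then i else j) =
  (fun k => if val k == 0%N then v i else v j) by [].
by apply/funext => k /=; case: ifP.
Qed.
End Definable.

Ltac definable_tac := rewrite ?/definable_sentence;
  repeat first
   [ apply: definable_orel2 | apply: definable_orel1 | apply: definable_eq
   | apply: definable_all | apply: definable_ex | apply: definable_card_ge
   | apply: definable_and | apply: definable_or
   | apply: definable_not | apply: definable_imp  ].

(** * Isomorphisms and elementary equivalence *)

Lemma isomorphic_sym (L : signature) A B (M : structure L A) (N : structure L B) :
  isomorphic M N -> isomorphic N M.
Proof.
move=> [f [[g fK gK] fP]]; exists g; split; first by exists f.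
move=> s v; rewrite fP.
by rewrite (_ : f \o (g \o v) = v) //; apply/funext => i /=.
Qed.

Lemma isomorphic_trans (L : signature) A B C (M : structure L A)
    (N : structure L B) (O : structure L C) :
  isomorphic M N -> isomorphic N O -> isomorphic M O.
Proof.
move=> [f [fbij fP]] [g [gbij gP]]; exists (g \o f); split; first exact: bij_comp.
by move=> s v; rewrite fP gP.
Qed.

Fixpoint quantifier_rank (L : signature) n (p : formula L n) : nat :=
  match p with
  | Fimp _ p q => maxn (quantifier_rank p) (quantifier_rank q)
  | Fall _ p => (quantifier_rank p).+1
  | _ => 0
  end.

(** The first index of [I] counts the rounds still to be played, and each quantifier consumes
    one. *)
Lemma back_and_forth_satisfies (L : signature) A B (M : structure L A)
    (N : structure L B)
    (I : nat -> forall n, ('I_n -> A) -> ('I_n -> B) -> Prop)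
    (I_eq : forall q n v w, I q n v w -> forall i j, v i = v j <-> w i = w j)
    (I_rel : forall q n v w, I q n v w -> forall (s : L) (u : 'I_(arity s) -> 'I_n),
      M s (v \o u) <-> N s (w \o u))
    (forth : forall q n v w, I q.+1 n v w -> forall a, exists b,
      I q n.+1 (extend a v) (extend b w))
    (back : forall q n v w, I q.+1 n v w -> forall b, exists a,
      I q n.+1 (extend a v) (extend b w)) n (p : formula L n) q v w :
  (quantifier_rank p <= q)%N -> I q n v w -> satisfies M p v <-> satisfies N p w.
Proof.
elim: p q v w => {n} [n|n i j|n s u|n p IHp p' IHp'|n p IHp] q v w //= pq Ivw.
- exact: I_eq Ivw i j.
- exact: I_rel Ivw s u.
- by move: pq; rewrite geq_max => /andP[pq pq']; rewrite (IHp q v w) ?(IHp' q v w).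
- case: q pq Ivw => // q pq Ivw; split=> h.
    by move=> b; have [a /(IHp q _ _ pq) <-] := back _ _ _ _ Ivw b.
  by move=> a; have [b /(IHp q _ _ pq) ->] := forth _ _ _ _ Ivw a.
Qed.

Definition matching (K U0 U1 : Type) (k0 : U0 -> K) (k1 : U1 -> K) n
    (v : 'I_n -> U0) (w : 'I_n -> U1) : Prop :=
  (forall i, k0 (v i) = k1 (w i)) /\ (forall i j, v i = v j <-> w i = w j).

(** A new point [a] needs a new answer in the fibre over its kind. If the [w i] exhausted that
    fibre, it would have at most [n < Q] elements, so both fibres would have the same finite size;
    but the fibre of [a] contains the corresponding [v i] and [a] besides. *)
Lemma matching_extend (K U0 U1 : Type) (k0 : U0 -> K) (k1 : U1 -> K) n
    (v : 'I_n -> U0) (w : 'I_n -> U1) Q a :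
  [set u | k0 u = k0 a] #= [set u | k1 u = k0 a] \/
    `I_Q #<= [set u | k1 u = k0 a] ->
  (n < Q)%N -> matching k0 k1 v w ->
  exists b, matching k0 k1 (extend a v) (extend b w).
Proof.
move=> fib nQ [kvw eqvw].
suff [b [kb eb]] : exists b, k0 a = k1 b /\ forall i, a = v i <-> b = w i.
  exists b; split=> [i|i j].
    by case: (unliftP ord0 i) => [i'|] ->; rewrite ?extendS ?extend0.
  case: (unliftP ord0 i) => [i'|] ->; case: (unliftP ord0 j) => [j'|] ->;
    rewrite ?extendS ?extend0 //.
  by split=> /esym /eb /esym.
have [[i ->]|fresh] := pselect (exists i, a = v i); first by exists (w i).
apply: contrapT => /forallNP nob.
have cov b : k1 b = k0 a -> exists i, b = w i.
  move=> kb; apply: contrapT => nw; apply: (nob b); split=> // i.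
  by split=> [av|bw]; [case: fresh|case: nw]; exists i.
(* The choice of [g] needs a default index. Without indices the fibre in [U1] would be empty, which
   both cases of [fib] exclude. *)
have inhI : inhabited 'I_n.
  apply: contrapT => noI.
  have fib0 : [set u | k1 u = k0 a] = set0.
    by rewrite -subset0 => b /cov[i _]; exact: noI (inhabits i).
  case: fib; rewrite fib0.
    rewrite card_eq0 => /eqP e; have : [set u | k0 u = k0 a] a by [].
    by rewrite e.
  move=> /card_le0P e; have : `I_Q 0%N by exact: leq_ltn_trans nQ.
  by rewrite e.
have /choice[g gP] : forall b, exists i, k1 b = k0 a -> b = w i.
  move=> b.
  have [/cov[i]|nk] := pselect (k1 b = k0 a); first by exists i.
  by case: inhI => i; exists i.
have fin1 : [set u | k1 u = k0 a] #<= `I_n.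
  apply: (@card_le_of_inj _ _ _ _ (fun b => val (g b))) => [b _|b b' kb kb' e] /=.
    exact: ltn_ord.
  by rewrite (gP _ kb) (gP _ kb') (val_inj e).
case: fib => [e01|QI]; last first.
  by have := card_le_trans QI fin1; rewrite card_le_II leqNgt nQ.
have /finite_setP[m em] : finite_set [set u | k1 u = k0 a].
  by apply/finite_set_leP; exists n.
have e0m := card_eq_trans e01 em.
suff : `I_m.+1 #<= [set u | k0 u = k0 a] by rewrite (card_le_eqr e0m) card_le_II ltnn.
apply/card_geSP; exists a => //; rewrite -(card_le_eql em).
apply: (@card_le_of_inj _ _ _ _ (fun b => v (g b))) => [b kb|b b' kb kb'].
  rewrite /= kvw -(gP _ kb); split=> // e; apply: fresh; by exists (g b).
by move=> /eqvw; rewrite -(gP _ kb) -(gP _ kb').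
Qed.

Lemma matching_sym (K U0 U1 : Type) (k0 : U0 -> K) (k1 : U1 -> K) n
    (v : 'I_n -> U0) (w : 'I_n -> U1) : matching k0 k1 v w -> matching k1 k0 w v.
Proof. by move=> [h1 h2]; split=> [i|i j]; [rewrite h1|rewrite h2]. Qed.

Lemma card_eq_fibres_bij (K U0 U1 : Type) (k0 : U0 -> K) (k1 : U1 -> K) :
  inhabited U1 -> (forall y, [set u | k0 u = y] #= [set u | k1 u = y]) ->
  exists2 f : U0 -> U1, bijective f & forall u, k1 (f u) = k0 u.
Proof.
move=> inh1 fib.
have [F FP] := choice (fun y => card_eq_ex_bij inh1 (fib y)).
have kF u : k1 (F (k0 u) u) = k0 u by case: (FP (k0 u)) => /(_ u erefl).
exists (fun u => F (k0 u) u) => //.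
rewrite -setTT_bijective; split => //.
  move=> u u' _ _ e; have ek : k0 u = k0 u' by rewrite -kF e kF.
  case: (FP (k0 u)) => _ /(_ u u') h _; apply: h => //.
  by rewrite e ek.
by move=> w _; case: (FP (k1 w)) => _ _ /(_ w erefl)[u /= ku <-]; exists u; rewrite ?ku.
Qed.

(** * Counting countable models *)

(** A covering family of least size is free of repetitions: of two isomorphic members, one could be
    dropped by [lift i]. *)
Lemma Ehrenfeucht_of_cover (L : signature) A (M : structure L A) n
    (F : 'I_n -> countable_model (theory M)) :
  (forall N : countable_model (theory M), exists i, isomorphic N (F i)) ->
  (exists N N' : countable_model (theory M), ~ isomorphic N N') -> Ehrenfeucht M.
Proof.
move=> Fcover [N [N' NN']].
pose covers k := `[< exists F : 'I_k -> countable_model (theory M),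
  forall N : countable_model (theory M), exists i, isomorphic N (F i) >].
have ex_covers : exists k, covers k by exists n; apply/asboolP; exists F.
case: (ex_minnP ex_covers) => k /asboolP[G Gcover] kmin.
have Ginj i j : isomorphic (G i) (G j) -> i = j.
  move=> Gij; apply: contrapT => /eqP ij.
  case: k G Gcover kmin i j Gij ij => [|k] G Gcover kmin i j Gij ij; first by case: i {Gij ij}.
  suff /kmin : covers k by rewrite ltnn.
  apply/asboolP; exists (G \o lift i) => O.
  have [i' Oi'] := Gcover O.
  case: (unliftP i i') => [l|] ei'; first by exists l; rewrite /= -ei'.
  case: (unliftP i j) => [l|] ej; last by rewrite ej eqxx in ij.
  exists l; rewrite /= -ej; apply: isomorphic_trans Oi' _; by rewrite ei'.
exists k; last by exists G.
have [i Ni] := Gcover N; have [j Nj] := Gcover N'.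
case: k G Gcover kmin Ginj i Ni j Nj => [|[|k]] // G _ _ _ i Ni j Nj; first by case: i Ni.
case: NN'; apply: isomorphic_trans Ni _; apply: isomorphic_sym.
by rewrite (ord1 i) -(ord1 j).
Qed.

(** A type that no model has is represented by an arbitrary model [N0], so it may remain undecided
    which of the [n] types occur. *)
Lemma Ehrenfeucht_of_types (L : signature) A (M : structure L A) n
    (tp : countable_model (theory M) -> 'I_n -> Prop) :
  (forall N, exists i, tp N i) ->
  (forall (N N' : countable_model (theory M)) i, tp N i -> tp N' i -> isomorphic N N') ->
  (exists N N' : countable_model (theory M), ~ isomorphic N N') -> Ehrenfeucht M.
Proof.
move=> tp_ex tp_iso nonisom.
have [N0 _] := nonisom.
have /choice[F FP] : forall i, exists N0, (exists N, tp N i) -> tp N0 i.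
  move=> i.
  have [[N NI]|no] := pselect (exists N, tp N i); first by exists N.
  by exists N0.
apply: (@Ehrenfeucht_of_cover _ _ _ _ F) nonisom => N.
have [i Ni] := tp_ex N; exists i; apply: (tp_iso _ _ _ Ni); apply: FP; by exists N.
Qed.

Lemma not_Ehrenfeucht_categorical (L : signature) A (M : structure L A) :
  (forall N N' : countable_model (theory M), isomorphic N N') -> ~ Ehrenfeucht M.
Proof.
move=> cat [[|[|k]] // _ [F [Finj _]]].
by have := Finj ord0 ord_max (cat _ _).
Qed.

(** * Cantor's theorem for dense total preorders *)

(** Strict inequality of [x] and [y] is written [~ le y x], which by totality entails [le x y]. *)
Record dense_preorder (U : Type) (Z : set U) (le : U -> U -> Prop) : Prop := {
  dense_neq0 : Z !=set0;
  dense_trans : forall x y z, Z x -> Z y -> Z z -> le x y -> le y z -> le x z;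
  dense_total : forall x y, Z x -> Z y -> le x y \/ le y x;
  dense_dense : forall x y, Z x -> Z y -> ~ le y x ->
    exists z, [/\ Z z, ~ le z x & ~ le y z];
  dense_left : forall x, Z x -> exists2 z, Z z & ~ le x z;
  dense_right : forall x, Z x -> exists2 z, Z z & ~ le z x }.

Lemma dense_preorder_rat : dense_preorder [set: rat] (fun x y => (x <= y)%R).
Proof.
split => //.
- by exists 0%R.
- by move=> x y z _ _ _; exact: le_trans.
- by move=> x y _ _; apply/orP; exact: le_total.
- move=> x y _ _ /negP; rewrite -ltNge => xy.
  exists ((x + y) / 2)%R; split => //; apply/negP; rewrite -ltNge.
    exact: (midf_lt xy).1.
  exact: (midf_lt xy).2.
- by move=> x _; exists (x - 1)%R => //; apply/negP; rewrite -ltNge ltrBlDr ltrDl.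
- by move=> x _; exists (x + 1)%R => //; apply/negP; rewrite -ltNge ltrDl.
Qed.

Lemma dense_flip (U : Type) (Z : set U) le :
  dense_preorder Z le -> dense_preorder Z (fun x y => le y x).
Proof.
case=> n0 tr tot ds l r; split => //.
- by move=> x y z Zx Zy Zz xy yz; exact: (tr _ y).
- by move=> x y Zx Zy; exact: tot.
- by move=> x y Zx Zy /(ds _ _ Zy Zx)[z [Zz zx yz]]; exists z.
Qed.

Lemma dense_preorder_max (U : eqType) (Z : set U) leU
    (dU : dense_preorder Z leU) (s : seq U) :
  (forall x, x \in s -> Z x) -> s = [::] \/
  exists2 m, m \in s & forall x, x \in s -> leU x m.
Proof.
elim: s => [|a s IHs] sZ; [by left|right].
have Za : Z a by apply: sZ; rewrite mem_head.
have sZ' x : x \in s -> Z x by move=> xs; apply: sZ; rewrite inE xs orbT.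
have aa : leU a a by case: (dense_total dU Za Za).
have [->|[m ms mmax]] := IHs sZ'.
  by exists a; rewrite ?mem_head // => x; rewrite inE => /eqP ->.
have Zm := sZ' _ ms.
have [am|ma] := dense_total dU Za Zm.
  exists m; first by rewrite inE ms orbT.
  by move=> x; rewrite inE => /orP[/eqP ->//|]; exact: mmax.
exists a; first exact: mem_head.
move=> x; rewrite inE => /orP[/eqP ->//|xs].
by apply: (dense_trans dU _ Zm) => //; [exact: sZ'|exact: mmax].
Qed.

Lemma dense_between (U : eqType) (Z : set U) le (dU : dense_preorder Z le)
    (s t : seq U) :
  (forall x, x \in s -> Z x) -> (forall x, x \in t -> Z x) ->
  (forall x y, x \in s -> y \in t -> ~ le y x) ->
  exists z, [/\ Z z, forall x, x \in s -> ~ le z x & forall y, y \in t -> ~ le y z].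
Proof.
move=> sZ tZ st.
have tr := dense_trans dU.
have [s0|[m ms mmax]] := dense_preorder_max dU sZ;
  have [t0|[l lt lmin]] := dense_preorder_max (dense_flip dU) tZ.
- by have [z Zz] := dense_neq0 dU; exists z; rewrite s0 t0; split.
- have [z Zz zl] := dense_left dU (tZ _ lt).
  exists z; split; rewrite ?s0 // => y yt yz; apply: zl.
  by apply: (tr _ y) => //; [exact: tZ|exact: tZ|exact: lmin].
- have [z Zz zm] := dense_right dU (sZ _ ms).
  exists z; split; rewrite ?t0 // => x xs zx; apply: zm.
  by apply: (tr _ x) => //; [exact: sZ|exact: sZ|exact: mmax].
- have [z [Zz zm lz]] := dense_dense dU (sZ _ ms) (tZ _ lt) (st _ _ ms lt).
  exists z; split => // [x xs zx|y yt yz]; [apply: zm|apply: lz].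
    by apply: (tr _ x) => //; [exact: sZ|exact: sZ|exact: mmax].
  by apply: (tr _ y) => //; [exact: tZ|exact: tZ|exact: lmin].
Qed.

(** The pairs need not form an injection: equivalent elements may share a partner. This lets a
    preorder be matched with [rat] without forming a quotient. *)
Definition partial_iso (U V : eqType) (Z : set U) (Y : set V)
    (leU : U -> U -> Prop) (leV : V -> V -> Prop) (l : seq (U * V)) : Prop :=
  (forall p, p \in l -> Z p.1 /\ Y p.2) /\
  (forall p q, p \in l -> q \in l -> leU p.1 q.1 <-> leV p.2 q.2).

(** A point equivalent to one already matched takes over its partner; any other point falls into a
    gap, and [dense_between] fills the corresponding gap on the other side. *)
Lemma partial_iso_forth (U V : eqType) (Z : set U) (Y : set V) leU leV
    (dU : dense_preorder Z leU) (dV : dense_preorder Y leV) l u :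
  partial_iso Z Y leU leV l -> Z u ->
  exists v, partial_iso Z Y leU leV ((u, v) :: l).
Proof.
move=> [lZY lle] Zu.
have trU := dense_trans dU; have trV := dense_trans dV.
have rU x : Z x -> leU x x by move=> Zx; case: (dense_total dU Zx Zx).
have rV x : Y x -> leV x x by move=> Zx; case: (dense_total dV Zx Zx).
suff [v [Yv vP]] : exists v, Y v /\ forall p, p \in l ->
    (leU u p.1 <-> leV v p.2) /\ (leU p.1 u <-> leV p.2 v).
  exists v; split=> [p|p q]; rewrite !inE.
    by move=> /orP[/eqP ->//|]; exact: lZY.
  move=> /orP[/eqP ->|pl] /orP[/eqP ->|ql] /=.
  - by split=> _; [exact: rV|exact: rU].
  - exact: (vP _ ql).1.
  - exact: (vP _ pl).2.
  - exact: lle.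
have [[p [pl up pu]]|nop] := pselect (exists p, [/\ p \in l, leU u p.1 & leU p.1 u]).
  have [Zp Yp] := lZY _ pl.
  exists p.2; split=> // q ql; have [Zq Yq] := lZY _ ql.
  rewrite -(lle _ _ pl ql) -(lle _ _ ql pl); split; split => h.
  - exact: (trU _ u).
  - exact: (trU _ p.1).
  - exact: (trU _ u).
  - exact: (trU _ p.1).
(* The partners of the points strictly below [u], and then of those strictly above. *)
pose s := [seq p.2 | p <- l & `[< ~ leU u p.1 >]].
pose t := [seq p.2 | p <- l & `[< ~ leU p.1 u >]].
have [v [Yv sv vt]] : exists z, [/\ Y z, forall x, x \in s -> ~ leV z x &
    forall y, y \in t -> ~ leV y z].
  apply: dense_between => //.
  - by move=> x /mapP[p]; rewrite mem_filter => /andP[_ /lZY[_ ?]] ->.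
  - by move=> x /mapP[p]; rewrite mem_filter => /andP[_ /lZY[_ ?]] ->.
  move=> x y /mapP[p pl ->] /mapP[q ql ->]; move: pl ql.
  rewrite !mem_filter => /andP[/asboolP up pl] /andP[/asboolP qu ql].
  have [Zp Yp] := lZY _ pl; have [Zq Yq] := lZY _ ql.
  move=> /(lle _ _ ql pl) qp; apply: up.
  by case: (dense_total dU Zu Zp) => // pu; case: qu; exact: (trU _ p.1).
exists v; split=> // p pl; have [Zp Yp] := lZY _ pl.
have [up|nup] := pselect (leU u p.1).
  have npu : ~ leU p.1 u by move=> pu; apply: nop; exists p.
  have nvp : ~ leV p.2 v.
    by apply: vt; apply/mapP; exists p; rewrite // mem_filter pl andbT; apply/asboolP.
  by have [//|vp] := dense_total dV Yp Yv.
have pu : leU p.1 u by have [] := dense_total dU Zu Zp.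
have npv : ~ leV v p.2.
  by apply: sv; apply/mapP; exists p; rewrite // mem_filter pl andbT; apply/asboolP.
by have [//|vp] := dense_total dV Yv Yp.
Qed.

Lemma partial_iso_back (U V : eqType) (Z : set U) (Y : set V) leU leV
    (dU : dense_preorder Z leU) (dV : dense_preorder Y leV) l v :
  partial_iso Z Y leU leV l -> Y v ->
  exists u, partial_iso Z Y leU leV ((u, v) :: l).
Proof.
have swap (U' V' : eqType) (Z' : set U') (Y' : set V') le1 le2 (l' : seq (U' * V')) :
    partial_iso Z' Y' le1 le2 l' ->
    partial_iso Y' Z' le2 le1 [seq (p.2, p.1) | p <- l'].
  move=> [lZY lle]; split=> [x /mapP[p pl ->]|x y /mapP[p pl ->] /mapP[q ql ->]] /=.
    by have [] := lZY _ pl.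
  by rewrite lle.
move=> /swap lP Yv; have [u /swap uP] := partial_iso_forth dV dU lP Yv.
exists u; move: uP; rewrite /= -map_comp (_ : map _ l = l) //.
by rewrite -[RHS]map_id; apply: eq_map => -[].
Qed.

(** The classes of the preorder become the fibres of [f], and [f] reaches every rational. *)
Lemma cantor_rat (U : Type) (Z : set U) le : countable [set: U] ->
  dense_preorder Z le ->
  exists f : U -> rat, (forall x y, Z x -> Z y -> le x y <-> (f x <= f y)%R) /\
    (forall r, exists2 x, Z x & f x = r).
Proof.
elim/Pchoice: U => U in Z le * => /countable_injP[e einj] dU.
have einj' x y : e x = e y -> x = y by apply: einj; rewrite in_setT.
pose good := partial_iso Z [set: rat] le (fun x y => (x <= y)%R).
(* Stage [n] adds the element of [Z] with code [n] and the rational with code [n], when they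
   exist. *)
have step (nl : nat * seq (U * rat)) : exists l', good nl.2 ->
    [/\ good l', {subset nl.2 <= l'},
      forall u, Z u -> e u = nl.1 -> exists v, (u, v) \in l' &
      forall v : rat, pickle v = nl.1 -> exists u, (u, v) \in l'].
  case: nl => n l /=.
  have [gl|ng] := pselect (good l); last by exists l.
  have [l1 [g1 s1 u1]] : exists l1, [/\ good l1, {subset l <= l1} &
      forall u, Z u -> e u = n -> exists v, (u, v) \in l1].
    have [[u [Zu en]]|no] := pselect (exists u, Z u /\ e u = n); last first.
      by exists l; split=> // u Zu en; case: no; exists u.
    have [v gv] := partial_iso_forth dU dense_preorder_rat gl Zu.
    exists ((u, v) :: l); split=> // [x xl|u' _ en']; first by rewrite inE xl orbT.
    by exists v; rewrite (einj' u' u) ?mem_head // en'.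
  have [[v en]|no] := pselect (exists v : rat, pickle v = n); last first.
    by exists l1 => _; split=> // v en; case: no; exists v.
  have [//|u gu] := partial_iso_back (v := v) dU dense_preorder_rat g1.
  exists ((u, v) :: l1) => _; split=> // [x xl|u' Zu' en'|v' en'].
  - by rewrite inE s1 ?orbT.
  - by have [w uw] := u1 _ Zu' en'; exists w; rewrite inE uw orbT.
  - by exists u; rewrite (pcan_inj pickleK (etrans en' (esym en))) mem_head.
have [F FP] := choice step.
pose l := fix l n := if n is n.+1 then F (n, l n) else [::].
have lgood n : good (l n).
  by elim: n => [|n IHn] //=; case: (FP (n, l n) IHn).
have lsub n m : (n <= m)%N -> {subset l n <= l m}.
  elim: m => [|m IHm]; first by rewrite leqn0 => /eqP ->.
  rewrite leq_eqVlt => /predU1P[->//|nm] x /(IHm nm) xl.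
  by case: (FP (m, l m) (lgood m)) => _ + _ _; apply.
have lle p q n m : p \in l n -> q \in l m -> le p.1 q.1 <-> (p.2 <= q.2)%R.
  move=> /(lsub _ _ (leq_maxl n m)) pl /(lsub _ _ (leq_maxr n m)) ql.
  by case: (lgood (maxn n m)) => _; apply.
have /choice[f fP] : forall u, exists r : rat, Z u -> exists n, (u, r) \in l n.
  move=> u; have [Zu|] := pselect (Z u); last by exists 0%R.
  case: (FP (e u, l (e u)) (lgood _)) => _ _ /(_ u Zu erefl)[v uv] _.
  by exists v => _; exists (e u).+1.
exists f; split=> [x y Zx Zy|r].
  have [n xn] := fP x Zx; have [m ym] := fP y Zy.
  exact: (lle (x, f x) (y, f y) n m).
case: (FP (pickle r, l (pickle r)) (lgood _)) => _ _ _ /(_ r erefl)[u ur].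
have {}ur : (u, r) \in l (pickle r).+1 by [].
have [Zu _] := (lgood (pickle r).+1).1 _ ur.
have [n un] := fP u Zu.
have uu : le u u by case: (dense_total dU Zu Zu).
exists u => //; apply/eqP; rewrite eq_le; apply/andP; split.
  exact: (lle (u, f u) (u, r) _ _ un ur).1.
exact: (lle (u, r) (u, f u) _ _ ur un).1.
Qed.

(** * Kinds of elements *)

(* An element of a countable model is a standard point [a] of the rigid part  *)
(* ([cD a]), a point of the pure set ([cR]), or a point of the field of the   *)
(* preorder: in a class of [n.+1] elements ([cF n]), in the least infinite    *)
(* class ([cL]), or in another infinite class ([cI]).                         *)
Inductive color (A : Type) := cD of A | cR | cF of nat | cL | cI.
Arguments cR {A}.
Arguments cF {A}.
Arguments cL {A}.
Arguments cI {A}.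

Definition color_lt A (c d : color A) : bool :=
  match c, d with
  | cF n, cF m => (n < m)%N
  | cF _, cL | cF _, cI | cL, cI => true
  | _, _ => false
  end.

Definition color_ordered A (c : color A) : bool :=
  match c with cF _ | cL | cI => true | _ => false end.

(* A color together with the position of the class inside the region.         *)
Definition kind A : Type := (color A * rat)%type.

Definition kind_le A (x y : kind A) : Prop :=
  color_lt x.1 y.1 \/ [/\ color_ordered x.1, x.1 = y.1 & (x.2 <= y.2)%R].

Lemma color_trichotomy A (c d : color A) : color_ordered c -> color_ordered d ->
  [\/ c = d, color_lt c d | color_lt d c].
Proof.
case: c => [a||n||] //; case: d => [b||m||] //= _ _;
  try by [constructor 1|constructor 2|constructor 3].
by case: (ltngtP n m) => [h|h|->]; [constructor 2|constructor 3|constructor 1].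
Qed.

Lemma color_lt_ordered A (c d : color A) :
  color_lt c d -> color_ordered c && color_ordered d.
Proof. by case: c => [a||n||] //; case: d. Qed.

Lemma color_lt_asym A (c d : color A) : color_lt c d -> ~~ color_lt d c.
Proof.
by case: c => [a||n||] //; case: d => [b||m||] //= nm; rewrite -leqNgt ltnW.
Qed.

Lemma color_ltxx A (c : color A) : color_lt c c = false.
Proof. by case: c => //= n; rewrite ltnn. Qed.

Lemma color_lt_trans A (c d e : color A) : color_lt c d -> color_lt d e -> color_lt c e.
Proof.
by case: c => [a||n||] //; case: d => [b||m||] //; case: e => //= l; exact: ltn_trans.
Qed.

Lemma kind_le_same A (x y : kind A) : x.1 = y.1 -> color_ordered x.1 ->
  kind_le x y <-> (x.2 <= y.2)%R.
Proof.
move=> xy ox; split=> [[|[]//]|h]; first by rewrite xy color_ltxx.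
by right.
Qed.

Lemma kind_le_diff A (x y : kind A) : x.1 <> y.1 -> kind_le x y <-> color_lt x.1 y.1.
Proof. by move=> xy; split=> [[|[]]//|h]; left. Qed.

Lemma kind_le_trans A (x y z : kind A) : kind_le x y -> kind_le y z -> kind_le x z.
Proof.
move=> [xy|[ox xy rxy]] [yz|[oy yz ryz]].
- by left; exact: color_lt_trans yz.
- by left; rewrite -yz.
- by left; rewrite xy.
- by right; split; rewrite ?xy // (le_trans rxy).
Qed.

Lemma kind_le_ordered A (x y : kind A) :
  kind_le x y -> color_ordered x.1 /\ color_ordered y.1.
Proof.
by move=> [/color_lt_ordered/andP[]//|[ox <- _]].
Qed.

Lemma kind_le_refl A (x : kind A) : kind_le x x <-> color_ordered x.1.
Proof. by split=> [/kind_le_ordered[]//|ox]; right. Qed.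

Lemma kind_le_total A (x y : kind A) : color_ordered x.1 -> color_ordered y.1 ->
  kind_le x y \/ kind_le y x.
Proof.
move=> ox oy; case: (color_trichotomy ox oy) => [exy|xy|yx].
- rewrite (kind_le_same exy ox) (kind_le_same (esym exy) oy).
  by apply/orP; exact: le_total.
- by left; left.
- by right; left.
Qed.

Lemma kind_le_anti A (x y : kind A) : kind_le x y -> kind_le y x -> x = y.
Proof.
move=> [xy|[ox xy rxy]] [yx|[oy yx ryx]].
- by have := color_lt_asym xy; rewrite yx.
- by move: xy; rewrite yx color_ltxx.
- by move: yx; rewrite xy color_ltxx.
- case: x y xy rxy yx ryx {ox oy} => [c r] [d q] /= -> rq _ qr.
  by congr pair; apply/eqP; rewrite eq_le rq.
Qed.

(** [None] is the countably infinite size. *)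
Definition size_set (s : option nat) : set nat := if s is Some n then `I_n else [set: nat].

(* A region is either a single class, at position 0, or a dense set of        *)
(* classes, of a common size.                                                 *)
Definition kind_size A (sh : color A -> bool * option nat) (x : kind A) : option nat :=
  if (sh x.1).1 || (x.2 == 0%R) then (sh x.1).2 else Some 0.

(* [t = Some (hasL, hasI)]: the preorder is present, and the flags tell which *)
(* infinite classes occur; [t = None]: there is no preorder.                  *)
Definition shape A (D : set A) (sR : option nat) (t : option (bool * bool))
    (c : color A) : bool * option nat :=
  match c with
  | cD a => (false, Some (nat_of_bool `[< D a >]))
  | cR => (false, sR)
  | cF n => if t is Some _ then (true, Some n.+1) else (false, Some 0)
  | cL => (false, if t is Some (true, _) then None else Some 0)
  | cI => if t is Some (_, true) then (true, None) else (false, Some 0)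
  end.

Lemma card_point_region (U : Type) (Z : set U) (s : option nat) : Z #= size_set s ->
  forall r : rat, [set u | Z u /\ 0%R = r] #= size_set (if r == 0%R then s else Some 0).
Proof.
move=> Zs r; case: eqVneq => [->|r0].
  by rewrite (_ : [set u | _] = Z) //; apply/seteqP; split=> u // [].
rewrite (_ : [set u | _] = set0) /= ?II0 //.
by rewrite -subset0 => u [_ e]; rewrite e eqxx in r0.
Qed.

Lemma card_dense_region (U : Type) (Z : set U) le (s : option nat) :
  countable [set: U] -> dense_preorder Z le ->
  (forall u, Z u -> [set v | Z v /\ le u v /\ le v u] #= size_set s) ->
  exists f : U -> rat, (forall u v, Z u -> Z v -> le u v <-> (f u <= f v)%R) /\
    (forall r, [set u | Z u /\ f u = r] #= size_set s).
Proof.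
move=> cU dZ cls; have [f [fle fonto]] := cantor_rat cU dZ.
exists f; split=> // r; have [u Zu <-] := fonto r.
rewrite (_ : [set u | _] = [set v | Z v /\ le u v /\ le v u]); first exact: cls.
apply/seteqP; split=> v /= [Zv].
  by move=> e; do !split => //; apply/fle => //; rewrite e.
move=> [/(fle _ _ Zu Zv) uv /(fle _ _ Zv Zu) vu]; split=> //.
by apply/eqP; rewrite eq_le vu.
Qed.

Lemma no_injection_cantor_space (e : (nat -> bool) -> nat) : ~ injective e.
Proof.
(* Cantor's diagonal function: at the code of [h] it takes the value opposite to that of [h]. *)
move=> einj; pose d n := `[< exists h, e h = n /\ h n = false >].
case: (boolP (d (e d))) => [dd|nd].
  by have /asboolP[h [/einj -> hd]] := dd; rewrite hd in dd.
by move: (nd) => /asboolP; apply; exists d; split=> //; exact/negbTE.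
Qed.

(** * The rigid part of a countable model *)

(* Naming the relations on [D] of arities 1 and 2 is enough to make [D] the   *)
(* same in all countable models.                                              *)
Record framed (L : signature) A (M : structure L A) (D : set A) (ord : option L) :
    Prop := {
  framed_countable : [set: A] #= [set: nat];
  framed_infinite : D = set0 \/ infinite_set D;
  framed_unary : forall X : set A, X `<=` D ->
    exists s, forall a, orel1 M s a <-> X a;
  framed_binary : forall X : A -> A -> Prop, (forall a b, X a b -> D a /\ D b) ->
    exists s, forall a b, orel2 M s a b <-> X a b;
  framed_support : forall s, ord <> Some s -> forall v, M s v -> forall i, D (v i);
  framed_arity : forall s, ord = Some s -> arity s = 2 }.

Lemma orel2E (L : signature) U (N : structure L U) (s : L) (as2 : arity s = 2) v :
  N s v = orel2 N (Some s) (v (cast_ord (esym as2) ord0)) (v (cast_ord (esym as2) ord_max)).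
Proof.
congr (N s); apply/funext => i; case: eqVneq => [i0|i0].
  by congr v; apply: val_inj.
congr v; apply: val_inj => /=.
by case: i i0 => -[|[|i]] //=; rewrite as2.
Qed.

Section Models.
Variables (L : signature) (A : Type) (M : structure L A) (D : set A) (ord : option L).
Arguments M : clear implicits.
Hypothesis frM : framed M D ord.
Variable J : A -> option L.
Hypothesis JP : forall a b, orel1 M (J a) b <-> b = a /\ D a.

Section Model.
Variables (U : Type) (N : structure L U).
Arguments N : clear implicits.
Hypothesis MN : theory M `<=` theory N.

(** In [M] the symbol [J a] names the singleton of [a] if [a] is in [D], and the empty relation
    otherwise. It acts as a constant symbol, and the elements it names in [N] are the standard
    ones. *)
Lemma std_uniq a u u' : orel1 N (J a) u -> orel1 N (J a) u' -> u = u'.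
Proof.
move: u u'; apply: (definable_transfer MN (P := fun U N => forall u u' : U,
  orel1 N (J a) u -> orel1 N (J a) u' -> u = u')); first by definable_tac.
by move=> b b' /JP[-> _] /JP[-> _].
Qed.

Lemma std_ex a : D a -> exists u, orel1 N (J a) u.
Proof.
move=> Da; apply: (definable_transfer MN (P := fun U N => exists u : U,
  orel1 N (J a) u)); first by definable_tac.
by exists a; apply/JP.
Qed.

Lemma std_mem a u : orel1 N (J a) u -> D a.
Proof.
move=> au; apply: contrapT => nDa; move: u au.
apply: (definable_transfer MN (P := fun U N => forall u : U,
  ~ orel1 N (J a) u)); first by definable_tac.
by move=> b /JP[].
Qed.

Lemma std_inj a b u : orel1 N (J a) u -> orel1 N (J b) u -> a = b.
Proof.
move=> au bu; apply: contrapT => ab; move: u au bu.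
apply: (definable_transfer MN (P := fun U N => forall u : U,
  orel1 N (J a) u -> ~ orel1 N (J b) u)); first by definable_tac.
by move=> c /JP[-> _] /JP[].
Qed.

(* In a nonstandard [u], the [2 ^ nat] functions sending [a] to a code of the *)
(* restriction of [g : nat -> bool] to [iota a] would take distinct values.   *)
Lemma std_exhaust (oD : option L) (oDP : forall a, orel1 M oD a <-> D a) u :
  countable [set: U] -> orel1 N oD u -> exists a, orel1 N (J a) u.
Proof.
move=> /countable_injP[e einj] uD; apply: contrapT => /forallNP nstd.
have inhA : inhabited A.
  apply: contrapT => noA; move: u uD {nstd}.
  apply: (definable_transfer MN (P := fun U N => forall u : U, ~ orel1 N oD u));
    first by definable_tac.
  by move=> a; case: noA.
have D0 : D !=set0.
  apply: contrapT => noD; move: u uD {nstd}.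
  apply: (definable_transfer MN (P := fun U N => forall u : U, ~ orel1 N oD u));
    first by definable_tac.
  by move=> a /oDP Da; apply: noD; exists a.
have Dinf : infinite_set D.
  by case: (framed_infinite frM) => // D_0; move: D0; rewrite D_0 => -[].
have [delta [deltaD delta_inj]] := card_le_ex_inj inhA ((infiniteP _).1 Dinf).
have [iota [_ iota_inj iota_surj]] :=
  card_eq_ex_bij (inhabits 0%N) (framed_countable frM).
have /choice[seg segP] : forall m : nat, exists s : option L,
    forall a, orel1 M s a <-> (D a /\ (iota a < m)%N).
  by move=> m; apply: (framed_unary frM) => a [].
(* Passing from [seg m] to [seg m.+1] adds at most one standard point, so a nonstandard [u] lies in
   no initial segment. *)
have segN m : ~ orel1 N (seg m) u.
  elim: m => [|m IHm] um.
    have h : forall x : U, ~ orel1 N (seg 0) x.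
      apply: (definable_transfer MN (P := fun U N => forall x : U, ~ orel1 N (seg 0) x));
        first by definable_tac.
      by move=> a /segP[].
    exact: h um.
  have [a _ am] := iota_surj m I.
  have h : forall x : U, orel1 N (seg m.+1) x -> orel1 N (seg m) x \/ orel1 N (J a) x.
    apply: (definable_transfer MN (P := fun U N => forall x : U,
      orel1 N (seg m.+1) x -> orel1 N (seg m) x \/ orel1 N (J a) x));
      first by definable_tac.
    move=> b /segP[Db]; rewrite ltnS leq_eqVlt => /predU1P[bm|bm].
      have -> : b = a by apply: iota_inj => //; rewrite bm am.
      by right; apply/JP; split=> //; rewrite -(iota_inj b a) // bm am.
    by left; apply/segP.
  by case: (h _ um) => //; exact: nstd.
pose F (g : nat -> bool) a := delta (pickle (mkseq g (iota a))).
have /choice[gr grP] : forall g : nat -> bool, exists s : option L,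
    forall a b, orel2 M s a b <-> (D a /\ b = F g a).
  move=> g; apply: (framed_binary frM) => a b [Da ->]; split=> //; exact: deltaD.
have /choice[y yP] : forall g, exists y, orel2 N (gr g) u y.
  move=> g; move: u uD {nstd segN}.
  apply: (definable_transfer MN (P := fun U N => forall x : U,
    orel1 N oD x -> exists y, orel2 N (gr g) x y)); first by definable_tac.
  by move=> a /oDP Da; exists (F g a); apply/grP.
apply: (@no_injection_cantor_space (e \o y)) => g h /einj; rewrite !in_setT => /(_ isT isT) ygh.
apply: contrapT => gh.
have [m gm] : exists m, g m <> h m.
  by apply: contrapT => /forallNP no; apply: gh; apply/funext => m; exact: contrapT (no m).
(* If [g] and [h] differ at [m], their codes can agree only at points [a] with [iota a <= m]. This
   transfers to [N], so equal values at [u] would put [u] into [seg m.+1]. *)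
apply: (segN m.+1).
have hy : orel2 N (gr h) u (y g) by rewrite ygh.
suff gh_seg : forall x z : U,
    orel2 N (gr g) x z -> orel2 N (gr h) x z -> orel1 N (seg m.+1) x.
  exact: gh_seg (yP g) hy.
apply: (definable_transfer MN (P := fun U N => forall x y : U,
  orel2 N (gr g) x y -> orel2 N (gr h) x y -> orel1 N (seg m.+1) x));
  first by definable_tac.
move=> a b /grP[Da ->] /grP[_ Fgh]; apply/segP; split=> //.
rewrite ltnNge; apply/negP => ma; apply: gm.
have /(pcan_inj pickleK) e' : pickle (mkseq g (iota a)) = pickle (mkseq h (iota a)).
  exact: delta_inj Fgh.
by rewrite -(nth_mkseq false g ma) e' nth_mkseq.
Qed.

(** No tuple is gained in [N]: by [std_exhaust] its components are named by symbols [J (a i)], and a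
    sentence decided in [M] says whether the tuple so named satisfies [s]. *)
Lemma rel_std (oD : option L) (oDP : forall a, orel1 M oD a <-> D a) s
    (v : 'I_(arity s) -> U) : countable [set: U] -> ord <> Some s ->
  N s v <-> exists2 a, M s a & forall i, orel1 N (J (a i)) (v i).
Proof.
move=> cU so; split=> [Nv|[a Ma av]].
  have vD i : orel1 N oD (v i).
    move: v Nv; apply: (definable_transfer MN (P := fun U N =>
      forall v : 'I_(arity s) -> U, N s v -> orel1 N oD (v i))).
      apply: definable_all_tuple; apply: definable_imp; last exact: definable_orel1.
      exact: (definable_rel (s := s) id).
    by move=> v /(framed_support frM so)/(_ i)/oDP.
  have /choice[a av] := fun i => std_exhaust oDP cU (vD i).
  exists a => //; apply: contrapT => nMa; move: v av Nv {vD}.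
  apply: (definable_transfer MN (P := fun U N => forall v : 'I_(arity s) -> U,
    (forall i, orel1 N (J (a i)) (v i)) -> ~ N s v)).
    apply: definable_all_tuple; apply: definable_imp.
      by apply: definable_all_ord => i; exact: definable_orel1.
    by apply: definable_not; exact: (definable_rel (s := s) id).
  by move=> v va; have -> : v = a by apply/funext => i; case/JP: (va i).
move: v av; apply: (definable_transfer MN (P := fun U N => forall v : 'I_(arity s) -> U,
  (forall i, orel1 N (J (a i)) (v i)) -> N s v)).
  apply: definable_all_tuple; apply: definable_imp.
    by apply: definable_all_ord => i; exact: definable_orel1.
  exact: (definable_rel (s := s) id).
by move=> v va; have -> : v = a by apply/funext => i; case/JP: (va i).
Qed.
End Model.

(** A labelling of this sort determines a countable model up to isomorphism, so models are counted
    by counting the shapes [sh]. *)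
Definition presents U (N : structure L U) (sh : color A -> bool * option nat)
    (k : U -> kind A) : Prop :=
  [/\ forall x, [set u | k u = x] #= size_set (kind_size sh x),
      forall a u, orel1 N (J a) u <-> (k u).1 = cD a &
      forall u v, orel2 N ord u v <-> kind_le (k u) (k v)].

(** Fibres over the same kind are equipotent, which gives a bijection that preserves kinds. The
    kinds determine all relations: [ord] through [kind_le], the others through [rel_std]. *)
Lemma presents_isomorphic (N N' : countable_model (theory M)) sh k k' :
  presents N sh k -> presents N' sh k' -> isomorphic N N'.
Proof.
move=> [ksz kJ kle] [ksz' kJ' kle'].
have [f fbij kf] : exists2 f : universe N -> universe N', bijective f &
    forall u, k' (f u) = k u.
  apply: card_eq_fibres_bij; first exact: universe_neq0.
  by move=> x; rewrite (card_eqr (ksz' x)) (ksz x).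
exists f; split=> // s v.
have [oD oDP] := framed_unary frM (@subset_refl _ D).
have [so|so] := pselect (ord = Some s).
  by rewrite !(orel2E _ (framed_arity frM so)) -so kle kle' /= !kf.
rewrite !(rel_std (@struct_models _ _ _) oDP) //; try exact: universe_countable.
split=> -[a Ma av]; exists a => // i.
  by apply/kJ'; rewrite /= kf; apply/kJ; exact: av.
by apply/kJ; rewrite -kf; apply/kJ'; exact: av.
Qed.

(** Positions may be chosen in each region separately, because colors alone decide the order between
    different regions. *)
Lemma presents_of_regions U (N : structure L U) sh (col : U -> color A) :
  (forall a u, orel1 N (J a) u <-> col u = cD a) ->
  (forall c, exists f : U -> rat,
    (forall r, [set u | col u = c /\ f u = r] #= size_set (kind_size sh (c, r))) /\
    (color_ordered c -> forall u v, col u = c -> col v = c ->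
      orel2 N ord u v <-> (f u <= f v)%R)) ->
  (forall u v, orel2 N ord u v -> color_ordered (col u) /\ color_ordered (col v)) ->
  (forall u v, color_lt (col u) (col v) -> orel2 N ord u v /\ ~ orel2 N ord v u) ->
  exists k, presents N sh k.
Proof.
move=> colJ /choice[f fP] le_col lt_col.
exists (fun u => (col u, f (col u) u)); split => //.
  move=> [c r]; have [fc _] := fP c.
  rewrite (_ : [set u | _] = [set u | col u = c /\ f c u = r]); first exact: fc.
  by apply/seteqP; split=> u /= [<- <-].
move=> u v; have [[ou ov]|nou] :=
    pselect (color_ordered (col u) /\ color_ordered (col v)); last first.
  by split=> [/le_col|/kind_le_ordered].
case: (color_trichotomy ou ov) => [euv|uv|vu].
- rewrite kind_le_same //= -euv.
  by have [_ ->] := fP (col u).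
- by split=> _; [left|have [] := lt_col _ _ uv].
- split=> [h|[uv|[_ /= e _]]].
  + by have [_] := lt_col _ _ vu.
  + by have := color_lt_asym vu; rewrite uv.
  + by move: vu; rewrite e color_ltxx.
Qed.

End Models.

(** * Classification of the countable models *)

Section Preorder.
Variables (L : signature) (ord : option L).

(* The class of [u] has more than [n] elements, as [u] itself is not counted. *)
Definition class_gt n U (N : structure L U) (u : U) : Prop :=
  `I_n #<= [set v | orel2 N ord u v /\ orel2 N ord v u /\ v <> u].

Definition finite_class n U (N : structure L U) (u : U) : Prop :=
  [/\ orel2 N ord u u, class_gt n N u & ~ class_gt n.+1 N u].

Definition infinite_class U (N : structure L U) (u : U) : Prop :=
  orel2 N ord u u /\ forall n, class_gt n N u.

(** Each field is a first-order sentence or a sequence of such sentences, and so passes to all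
    models of the theory; conjunctions are kept binary for [definable_tac]. Together with
    [graded_mono], the last two fields say that the classes of size [n.+1] have no least and no
    greatest member. *)
Record graded_preorder U (N : structure L U) : Prop := {
  graded_field : forall u v, orel2 N ord u v -> orel2 N ord u u /\ orel2 N ord v v;
  graded_trans : forall u v w, orel2 N ord u v -> orel2 N ord v w -> orel2 N ord u w;
  graded_total : forall u v, orel2 N ord u u -> orel2 N ord v v ->
    orel2 N ord u v \/ orel2 N ord v u;
  graded_dense : forall u v, orel2 N ord u v -> ~ orel2 N ord v u -> exists w,
    orel2 N ord u w /\ ~ orel2 N ord w u /\ orel2 N ord w v /\ ~ orel2 N ord v w;
  graded_right : forall u, orel2 N ord u u -> exists v,
    orel2 N ord u v /\ ~ orel2 N ord v u;
  graded_mono : forall n u v, orel2 N ord u v -> class_gt n N u -> class_gt n N v;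
  graded_ex : forall n, exists u,
    orel2 N ord u u /\ class_gt n N u /\ ~ class_gt n.+1 N u;
  graded_low : forall n u, orel2 N ord u u -> class_gt n N u ->
    ~ class_gt n.+1 N u -> exists v,
    orel2 N ord v u /\ ~ orel2 N ord u v /\ class_gt n N v;
  graded_high : forall n u, orel2 N ord u u -> class_gt n N u ->
    ~ class_gt n.+1 N u -> exists v,
    orel2 N ord u v /\ ~ orel2 N ord v u /\ ~ class_gt n.+1 N v }.

Lemma graded_preorder_transfer A (M : structure L A) U (N : structure L U) :
  theory M `<=` theory N -> graded_preorder M -> graded_preorder N.
Proof.
move=> MN; case=> field trans total dense right mono ex low high; split.
- by move: field; apply: (definable_transfer MN (P := fun U N => forall u v : U, _));
    definable_tac.
- by move: trans; apply: (definable_transfer MN (P := fun U N => forall u v w : U, _));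
    definable_tac.
- by move: total; apply: (definable_transfer MN (P := fun U N => forall u v : U, _));
    definable_tac.
- by move: dense; apply: (definable_transfer MN (P := fun U N => forall u v : U, _));
    definable_tac.
- by move: right; apply: (definable_transfer MN (P := fun U N => forall u : U, _));
    definable_tac.
- move=> n; move: (mono n); rewrite /class_gt.
  by apply: (definable_transfer MN (P := fun U N => forall u v : U, _)); definable_tac.
- move=> n; move: (ex n); rewrite /class_gt.
  by apply: (definable_transfer MN (P := fun U N => exists u : U, _)); definable_tac.
- move=> n; move: (low n); rewrite /class_gt.
  by apply: (definable_transfer MN (P := fun U N => forall u : U, _)); definable_tac.
- move=> n; move: (high n); rewrite /class_gt.
  by apply: (definable_transfer MN (P := fun U N => forall u : U, _)); definable_tac.
Qed.

Section Graded.
Variables (U : Type) (N : structure L U).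
Hypothesis grN : graded_preorder N.
Let le := orel2 N ord.

Lemma class_gt_le n m u : (n <= m)%N -> class_gt m N u -> class_gt n N u.
Proof. by move=> nm; apply: card_le_trans; rewrite card_le_II. Qed.

Lemma finite_class_inj n m u : finite_class n N u -> finite_class m N u -> n = m.
Proof.
move=> [_ n1 n2] [_ m1 m2]; case: (ltngtP n m) => // h.
  by case: n2; exact: class_gt_le h m1.
by case: m2; exact: class_gt_le h n1.
Qed.

Lemma finite_or_infinite_class u : le u u ->
  (exists n, finite_class n N u) \/ infinite_class N u.
Proof.
move=> uu; have [h|/existsNP ex] := pselect (forall n, class_gt n N u); [by right|left].
have {}ex : exists n, `[< ~ class_gt n N u >] by case: ex => n h; exists n; apply/asboolP.
case: (ex_minnP ex) => -[|n] /asboolP h nmin.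
  by case: h; rewrite /class_gt II0.
exists n; split => //; apply: contrapT => h'.
have : (n < n)%N by apply: nmin; apply/asboolP.
by rewrite ltnn.
Qed.

(** By [graded_mono] the classes of a given size form a convex set, which inherits density from the
    whole preorder. *)
Lemma dense_preorder_finite_class n : dense_preorder [set u | finite_class n N u] le.
Proof.
have tr := graded_trans grN.
split => /=.
- by have [u [uu [h1 h2]]] := graded_ex grN n; exists u.
- by move=> x y z _ _ _; exact: tr.
- by move=> x y [xx _ _] [yy _ _]; exact: graded_total.
- move=> x y [xx x1 x2] [yy y1 y2] yx.
  have xy : le x y by case: (graded_total grN xx yy).
  have [w [xw [wx [wy yw]]]] := graded_dense grN xy yx.
  exists w; split => //; split.
  + by case: (graded_field grN xw).
  + exact: graded_mono xw x1.
  + by move=> /(graded_mono grN wy).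
- move=> x [xx x1 x2]; have [w [wx [xw w1]]] := graded_low grN xx x1 x2.
  exists w => //; split=> //; first by case: (graded_field grN wx).
  by move=> /(graded_mono grN wx).
- move=> x [xx x1 x2]; have [w [wx [xw w1]]] := graded_high grN xx x1 x2.
  exists w => //; split=> //; first by case: (graded_field grN wx).
  exact: graded_mono wx x1.
Qed.

Lemma card_finite_class n u : finite_class n N u ->
  [set v | finite_class n N v /\ le u v /\ le v u] #= `I_n.+1.
Proof.
move=> fu; have [uu u1 u2] := fu.
apply/(@card_eqS_rem _ _ u); first by [].
rewrite (_ : [set v | _] = [set v | le u v /\ le v u /\ v <> u]); first exact/card_eq_II_le.
apply/seteqP; split=> v /=; first by move=> [[_ [uv vu]] nvu].
move=> [uv [vu nvu]]; do !split => //.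
- by case: (graded_field grN uv).
- exact: graded_mono uv u1.
- by move=> /(graded_mono grN vu).
Qed.

Definition least_infinite u : Prop :=
  infinite_class N u /\ forall v, infinite_class N v -> le u v.

Lemma infinite_class_up u v : le u v -> infinite_class N u -> infinite_class N v.
Proof.
move=> uv [uu h]; split; first by case: (graded_field grN uv).
by move=> n; exact: graded_mono uv (h n).
Qed.

Lemma card_infinite_class u : countable [set: U] -> infinite_class N u ->
  [set v | le u v /\ le v u] #= [set: nat].
Proof.
move=> cU [uu h]; apply: eq_card_nat.
  by apply: sub_countable cU; exact: card_leT.
apply: infinite_card_ge => k; apply: card_le_trans (h k) _.
by apply: subset_card_le => v [uv [vu _]].
Qed.

(** Whatever lies strictly above an infinite class is infinite and not least. For the missing left
    endpoint: if [x] is not least, some infinite [v] lies strictly below it, and a point strictly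
    between them is again not least. *)
Lemma dense_preorder_infinite_class : (exists u, infinite_class N u) ->
  dense_preorder [set u | infinite_class N u /\ ~ least_infinite u] le.
Proof.
move=> [u0 iu0].
have tr := graded_trans grN; have tot := graded_total grN.
have above x y : infinite_class N x -> le x y -> ~ le y x ->
    infinite_class N y /\ ~ least_infinite y.
  move=> ix xy yx; split; first exact: infinite_class_up ix.
  by move=> [_ /(_ x ix)].
have right x : infinite_class N x -> exists2 z,
    infinite_class N z /\ ~ least_infinite z & ~ le z x.
  move=> ix; have [z [xz zx]] := graded_right grN ix.1.
  by exists z => //; exact: above xz zx.
split => /=.
- by have [z] := right u0 iu0; exists z.
- by move=> x y z _ _ _; exact: tr.
- by move=> x y [[xx _] _] [[yy _] _]; exact: tot.
- move=> x y [ix nx] [iy ny] yx.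
  have xy : le x y by case: (tot _ _ ix.1 iy.1).
  have [w [xw [wx [wy yw]]]] := graded_dense grN xy yx.
  by exists w; split=> //; exact: above xw wx.
- move=> x [ix nx].
  have [v [iv xv]] : exists v, infinite_class N v /\ ~ le x v.
    apply: contrapT => /forallNP no; apply: nx; split=> // v iv.
    by apply: contrapT => h; apply: (no v).
  have vx : le v x by case: (tot _ _ ix.1 iv.1).
  have [w [vw [wv [wx xw]]]] := graded_dense grN vx xv.
  by exists w => //; exact: above vw wv.
- by move=> x [ix _]; exact: right.
Qed.
End Graded.
End Preorder.

Lemma size_set_eq0 (U : Type) (Z : set U) (s : option nat) :
  Z #= size_set s -> s <> Some 0 <-> Z !=set0.
Proof.
move=> Zs; split=> [s0|[u Zu] s0].
  apply/set0P/negP => /eqP Z0; move: Zs.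
  rewrite Z0 card_eq_sym card_eq0 => /eqP e; case: s s0 e => [[|n]|] // _ /= e.
    by have : `I_n.+1 0%N by []; rewrite e.
  by have : [set: nat] 0%N by []; rewrite e.
by move: Zs; rewrite s0 /= II0 card_eq0 => /eqP e; rewrite e in Zu.
Qed.

Section Classification.
Variables (L : signature) (A : Type) (M : structure L A) (D : set A) (ord : option L).
Hypothesis frM : framed M D ord.
Variable J : A -> option L.
Hypothesis JP : forall a b, orel1 M (J a) b <-> b = a /\ D a.
Variable oD : option L.
Hypothesis oDP : forall a, orel1 M oD a <-> D a.
Variable sR : option nat.
Hypothesis sRP : sR = None \/ sR = Some 0.

Notation presents := (@presents L A ord J _).

Lemma presents_size U (N : structure L U) sh k u :
  presents N sh k -> kind_size sh (k u) <> Some 0.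
Proof. by move=> [ksz _ _]; apply/(size_set_eq0 (ksz (k u))); exists u. Qed.

Lemma presents_onto U (N : structure L U) sh k x :
  presents N sh k -> kind_size sh x <> Some 0 -> exists u, k u = x.
Proof. by move=> [ksz _ _] /(size_set_eq0 (ksz x))[u]; exists u. Qed.

Lemma presents_pure_part t k : presents M (shape D sR t) k ->
  [set u | ~ orel1 M oD u /\ ~ orel2 M ord u u] #= size_set sR.
Proof.
move=> kP; have [ksz kJ kle] := kP.
have := ksz (cR, 0%R); rewrite /kind_size /=.
rewrite (_ : [set u | k u = _] = [set u | ~ orel1 M oD u /\ ~ orel2 M ord u u]) //.
apply/seteqP; split=> u /=.
  move=> ku; split; last by rewrite kle ku kind_le_refl.
  move=> /oDP Du; have : orel1 M (J u) u by apply/JP.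
  by move/kJ; rewrite ku.
move=> [nDu nuu]; have := presents_size (u := u) kP.
move: nuu; rewrite kle kind_le_refl.
case ku: (k u) => [c r]; case: c ku => [a||n||] //= ku.
  by case: nDu; apply/oDP; have /JP[-> ] : orel1 M (J a) u by apply/kJ; rewrite ku.
by move=> _; rewrite /kind_size /=; case: eqVneq => [->|].
Qed.

Section Model.
Variables (U : Type) (N : structure L U).
Hypothesis MN : theory M `<=` theory N.
Hypothesis cU : countable [set: U].

Lemma model_pure_part :
  [set u | ~ orel1 M oD u /\ ~ orel2 M ord u u] #= size_set sR ->
  [set u | ~ orel1 N oD u /\ ~ orel2 N ord u u] #= size_set sR.
Proof.
case: sRP => -> /= Rcard.
  apply: eq_card_nat; first by apply: sub_countable cU; exact: card_leT.
  apply: infinite_card_ge => n.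
  apply: (definable_transfer MN (P := fun U N =>
    `I_n #<= [set u : U | ~ orel1 N oD u /\ ~ orel2 N ord u u])); first by definable_tac.
  by rewrite (card_le_eqr Rcard); exact: card_leT.
rewrite II0 card_eq0; apply/eqP; rewrite -subset0.
apply: (definable_transfer MN (P := fun U N => forall u : U,
  ~ orel1 N oD u /\ ~ orel2 N ord u u -> False)); first by definable_tac.
move: Rcard; rewrite II0 card_eq0 => /eqP e a h.
by have : [set u | ~ orel1 M oD u /\ ~ orel2 M ord u u] a by []; rewrite e.
Qed.

Definition has_color (u : U) (c : color A) : Prop :=
  match c with
  | cD a => orel1 N (J a) u
  | cR => ~ orel1 N oD u /\ ~ orel2 N ord u u
  | cF n => finite_class ord n N u
  | cL => least_infinite ord N u
  | cI => infinite_class ord N u /\ ~ least_infinite ord N u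
  end.

Hypothesis Rcard : [set u | ~ orel1 N oD u /\ ~ orel2 N ord u u] #= size_set sR.
Hypothesis JN : forall a u, orel1 N (J a) u -> ~ orel2 N ord u u.

Lemma J_sub_D a u : orel1 N (J a) u -> orel1 N oD u.
Proof.
move: u; apply: (definable_transfer MN (P := fun U N => forall u : U,
  orel1 N (J a) u -> orel1 N oD u)); first by definable_tac.
by move=> b /JP[-> Da]; apply/oDP.
Qed.

Lemma has_color_ex u : exists c, has_color u c.
Proof.
have [[a au]|nJ] := pselect (exists a, orel1 N (J a) u); first by exists (cD a).
have [uu|nuu] := pselect (orel2 N ord u u); last first.
  exists cR; split=> // uD; apply: nJ; exact: (std_exhaust frM JP MN oDP cU uD).
have [[n fu]|iu] := finite_or_infinite_class uu; first by exists (cF n).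
have [lu|nlu] := pselect (least_infinite ord N u); first by exists cL.
by exists cI.
Qed.

Lemma has_color_uniq u c d : has_color u c -> has_color u d -> c = d.
Proof.
have inf_fin n : infinite_class ord N u -> ~ finite_class ord n N u.
  by move=> [_ h] [_ _]; apply.
case: c => [a||n||]; case: d => [b||m||] //=.
- by move=> au bu; congr cD; exact: (std_inj JP MN au bu).
- by move=> /J_sub_D uD [].
- by move=> /JN nu [].
- by move=> /JN nu [[]].
- by move=> /JN nu [[]].
- by move=> [nD _] /J_sub_D.
- by move=> [_ nu] [].
- by move=> [_ nu] [[]].
- by move=> [_ nu] [[]].
- by move=> [uu _ _] /JN.
- by move=> [uu _ _] [].
- by move=> fn fm; congr cF; exact: (finite_class_inj fn fm).
- by move=> fn [iu _]; case: (inf_fin _ iu fn).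
- by move=> fn [iu _]; case: (inf_fin _ iu fn).
- by move=> [[uu _] _] /JN.
- by move=> [[uu _] _] [].
- by move=> [iu _] /(inf_fin _ iu).
- by move=> lu [].
- by move=> [[uu _] _] /JN.
- by move=> [[uu _] _] [].
- by move=> [iu _] /(inf_fin _ iu).
- by move=> [].
Qed.

Lemma color_function : exists col : U -> color A, forall u c, col u = c <-> has_color u c.
Proof.
have /choice[col colP] := has_color_ex; exists col => u c.
by split=> [<-//|]; exact: has_color_uniq.
Qed.

Lemma point_region (sh : color A -> bool * option nat) col c :
  (forall u d, col u = d <-> has_color u d) -> (sh c).1 = false ->
  [set u | has_color u c] #= size_set (sh c).2 ->
  (color_ordered c -> forall u v, has_color u c -> has_color v c -> orel2 N ord u v) ->
  exists f : U -> rat,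
    (forall r, [set u | col u = c /\ f u = r] #= size_set (kind_size sh (c, r))) /\
    (color_ordered c -> forall u v, col u = c -> col v = c ->
      orel2 N ord u v <-> (f u <= f v)%R).
Proof.
move=> colP shc cc cle; exists (fun=> 0%R); split=> [r|oc u v /colP uc /colP vc].
  rewrite /kind_size /= shc /=.
  rewrite (_ : [set u | _ /\ _] = [set u | [set u | has_color u c] u /\ 0%R = r]).
    exact: card_point_region.
  by apply/seteqP; split=> u /= [/colP h e].
by split=> // _; exact: cle.
Qed.

Lemma dense_region (sh : color A -> bool * option nat) col c :
  (forall u d, col u = d <-> has_color u d) -> (sh c).1 = true ->
  dense_preorder [set u | has_color u c] (orel2 N ord) ->
  (forall u, has_color u c ->
    [set v | has_color v c /\ orel2 N ord u v /\ orel2 N ord v u] #= size_set (sh c).2) ->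
  exists f : U -> rat,
    (forall r, [set u | col u = c /\ f u = r] #= size_set (kind_size sh (c, r))) /\
    (color_ordered c -> forall u v, col u = c -> col v = c ->
      orel2 N ord u v <-> (f u <= f v)%R).
Proof.
move=> colP shc dc cc.
have [f [fle fr]] := card_dense_region cU dc cc.
exists f; split=> [r|oc u v /colP uc /colP vc]; last exact: fle.
rewrite /kind_size /= shc /=.
rewrite (_ : [set u | _ /\ _] = [set u | has_color u c /\ f u = r]); first exact: fr.
by apply/seteqP; split=> u /= [/colP h e].
Qed.

Lemma rigid_region a : [set u | has_color u (cD a)] #= `I_(nat_of_bool `[< D a >]).
Proof.
case: asboolP => [Da|nDa] /=.
  have [u au] := std_ex JP MN Da.
  rewrite (_ : [set u | _] = [set u]); first exact: card_set1.
  by apply/seteqP; split=> [v /= av|v /= ->//]; exact: (std_uniq JP MN av au).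
rewrite II0 card_eq0; apply/eqP; rewrite -subset0 => u /=.
by move=> /(std_mem JP MN).
Qed.

Lemma classify_rigid : (forall u v, ~ orel2 N ord u v) ->
  exists k, presents N (shape D sR None) k.
Proof.
move=> nle; have [col colP] := color_function.
apply: (@presents_of_regions _ _ _ _ _ _ _ col) => //.
- by move=> a u; split=> [h|/colP//]; exact/colP.
- move=> c; apply: point_region => //; first by case: c.
    case: c => [a||n||] /=; first exact: rigid_region; first exact: Rcard.
    + by rewrite II0 card_eq0; apply/eqP; rewrite -subset0 => u [/nle].
    + by rewrite II0 card_eq0; apply/eqP; rewrite -subset0 => u [[/nle]].
    + by rewrite II0 card_eq0; apply/eqP; rewrite -subset0 => u [[/nle]].
  by case: c => [a||n||] //= _ u v; [case|case; case|case; case] => /nle.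
- by move=> u v /nle.
- move=> u v; case eu: (col u) => [a||n||] //; move/colP: eu.
    by case=> /nle.
  by case; case=> /nle.
Qed.

(** The pair [(true, false)] cannot occur, as a least infinite class is an infinite class. Once
    [hasI] holds, the region [cI] is nonempty, because [graded_right] gives a class above any
    other. *)
Lemma classify_graded : graded_preorder ord N ->
  exists t, (t = (false, false) \/ t = (false, true) \/ t = (true, true)) /\
    exists k, presents N (shape D sR (Some t)) k.
Proof.
move=> grN; have [col colP] := color_function.
pose hasI := `[< exists u, infinite_class ord N u >].
pose hasL := `[< exists u, least_infinite ord N u >].
exists (hasL, hasI); split.
  rewrite /hasL /hasI; case: asboolP => [[u [iu _]]|_]; case: asboolP => [_|no].
  - by right; right.
  - by case: no; exists u.
  - by right; left.
  - by left.
apply: (@presents_of_regions _ _ _ _ _ _ _ col).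
- by move=> a u; split=> [h|/colP//]; exact/colP.
- move=> [a||n||].
  + by apply: point_region => //; exact: rigid_region.
  + by apply: point_region => //; exact: Rcard.
  + by apply: dense_region => //= [|u];
      [exact: dense_preorder_finite_class|exact: card_finite_class].
  + apply: point_region => //=.
      rewrite /hasL; case: asboolP => [[u [iu lu]]|no] /=.
        rewrite (_ : [set u | _] = [set v | orel2 N ord u v /\ orel2 N ord v u]).
          exact: card_infinite_class.
        apply/seteqP; split=> v /=; first by move=> [iv lv]; split; [exact: lu|exact: lv].
        move=> [uv vu]; split; first exact: infinite_class_up uv iu.
        by move=> w /lu uw; exact: graded_trans vu uw.
      by rewrite II0 card_eq0; apply/eqP; rewrite -subset0 => u lu; apply: no; exists u.
    by move=> _ u v [iu lu] [iv _]; exact: lu.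
  + have [exI|noI] := pselect (exists u, infinite_class ord N u).
      have eI : hasI = true by apply/asboolP.
      apply: dense_region => //=; rewrite ?eI //.
        exact: dense_preorder_infinite_class.
      move=> u [iu nlu] /=; rewrite -(card_eqr (card_infinite_class cU iu)).
      rewrite (_ : [set v | _ /\ _ /\ _] = [set v | orel2 N ord u v /\ orel2 N ord v u]) //.
      apply/seteqP; split=> v /=; first by move=> [_ [uv vu]].
      move=> [uv vu]; split=> //; split; first exact: (infinite_class_up grN uv iu).
      move=> [iv lv]; apply: nlu; split=> // w /lv vw; exact: graded_trans uv vw.
    have eI : hasI = false by apply/asboolP.
    apply: point_region => //=; rewrite ?eI //=.
      by rewrite II0 card_eq0; apply/eqP; rewrite -subset0 => u [iu _]; apply: noI; exists u.
    by move=> _ u v [iu _]; case: noI; exists u.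
- have ordered u : orel2 N ord u u -> color_ordered (col u).
    move=> uu; case eu: (col u) => [a||n||] //; move/colP: eu => /=; first by move/JN.
    by case.
  by move=> u v /(graded_field grN)[/ordered ? /ordered ?].
- move=> u v.
  suff h : color_lt (col u) (col v) -> orel2 N ord u u /\ orel2 N ord v v /\ ~ orel2 N ord v u.
    by move=> /h[uu [vv nvu]]; split=> //; case: (graded_total grN uu vv).
  have mono := graded_mono grN.
  case eu: (col u) => [a||n||] //; case ev: (col v) => [b||m||] //=;
    move/colP: eu => /= eu; move/colP: ev => /= ev nm.
  + have [uu u1 u2] := eu; have [vv v1 v2] := ev; split=> //; split=> // vu.
    by apply: u2; apply: (class_gt_le nm); exact: mono vu v1.
  + have [uu u1 u2] := eu; have [[vv v1] _] := ev; split=> //; split=> // vu.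
    by apply: u2; exact: mono vu (v1 _).
  + have [uu u1 u2] := eu; have [[vv v1] _] := ev; split=> //; split=> // vu.
    by apply: u2; exact: mono vu (v1 _).
  + have [iu lu] := eu; have [iv nlv] := ev.
    split; [exact: iu.1|split; [exact: iv.1|]] => vu; apply: nlv; split=> // w /lu uw.
    exact: graded_trans vu uw.
Qed.
End Model.
End Classification.

(** * A nonstandard model *)

(** An ordered sum of copies of [rat] is dense without endpoints whatever the order of the summands.
    Hence any set of ordered regions can be merged into one copy of [rat]. *)
Lemma dense_preorder_kind A (C : color A -> Prop) : (exists c, C c) ->
  (forall c, C c -> color_ordered c) ->
  dense_preorder [set x : kind A | C x.1] (@kind_le A).
Proof.
move=> [c0 Cc0] Co.
have shiftr (x : kind A) q : C x.1 -> (x.2 < q)%R -> ~ kind_le (x.1, q) x.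
  by move=> Cx xq; rewrite kind_le_same //= => [|]; [rewrite leNgt xq|exact: Co].
have shiftl (x : kind A) q : C x.1 -> (q < x.2)%R -> ~ kind_le x (x.1, q).
  by move=> Cx xq; rewrite kind_le_same //= => [|]; [rewrite leNgt xq|exact: Co].
split => /=.
- by exists (c0, 0%R).
- by move=> x y z _ _ _; exact: kind_le_trans.
- by move=> x y /Co ox /Co oy; exact: kind_le_total.
- move=> x y Cx Cy yx.
  have [exy|nxy] := pselect (x.1 = y.1).
    have xy : (x.2 < y.2)%R.
      by rewrite ltNge; apply/negP => h; apply: yx; apply/kind_le_same => //; exact: Co.
    exists (x.1, ((x.2 + y.2) / 2)%R); split=> //.
      by apply: shiftr => //; exact: (midf_lt xy).1.
    by rewrite exy; apply: shiftl => //; exact: (midf_lt xy).2.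
  exists (x.1, (x.2 + 1)%R); split=> //; first by apply: shiftr => //; rewrite ltrDl.
  by rewrite kind_le_diff /= => [h|/esym//]; apply: yx; left.
- by move=> x Cx; exists (x.1, (x.2 - 1)%R) => //; apply: shiftl => //; rewrite ltrBlDr ltrDl.
- by move=> x Cx; exists (x.1, (x.2 + 1)%R) => //; apply: shiftr => //; rewrite ltrDl.
Qed.

Lemma countable_kind_nat A : countable [set: A] -> countable [set: kind A * nat].
Proof.
move=> /countable_injP[iota iota_inj].
pose code (c : color A) : nat * nat :=
  match c with
  | cD a => (0, iota a) | cR => (1, 0) | cF n => (2, n) | cL => (3, 0) | cI => (4, 0)
  end.
have code_inj : injective code.
  move=> [a||n||] [b||m||] //= [] => [|->//].
  by move/iota_inj; rewrite !in_setT => /(_ isT isT) ->.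
apply/countable_injP; exists (fun x => pickle (code x.1.1, x.1.2, x.2)).
move=> [[c r] i] [[d q] j] _ _ /(pcan_inj pickleK) [/code_inj -> -> ->] //.
Qed.

Lemma countable_kind A : countable [set: A] -> countable [set: kind A].
Proof.
move=> /countable_kind_nat; apply: sub_countable.
by apply: (@card_le_of_inj _ _ _ _ (fun x => (x, 0))) => // x y _ _ [].
Qed.

Definition large_color A Q (c : color A) : bool :=
  match c with cF n => (Q <= n)%N | cI => true | _ => false end.

(* Sentences of quantifier rank at most [Q] cannot tell apart classes of      *)
(* more than [Q] elements, so that all such classes are merged into one dense *)
(* region.                                                                    *)
Definition truncate_kind A Q (f : kind A -> rat) (x : kind A) : kind A :=
  if large_color Q x.1 then (cI, f x) else x.

(** [cL] lies between the large colors [cF n] and [cI] without being large itself; merging respects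
    the order because [trunc_least] leaves [cL] empty. By [trunc_onto] every merged class has at
    least [Q] elements. *)
Record truncation A Q (sh0 : color A -> bool * option nat) U (k : U -> kind A)
    (sh : color A -> bool * option nat) (f : kind A -> rat) : Prop := {
  trunc_size : forall x, [set u | k u = x] #= size_set (kind_size sh x);
  trunc_small : forall c, ~~ large_color Q c -> sh c = sh0 c;
  trunc_least : sh0 cL = (false, Some 0);
  trunc_onto : forall r, exists x,
    [/\ large_color Q x.1, f x = r & `I_Q #<= size_set (kind_size sh x)];
  trunc_le : forall x y, large_color Q x.1 -> large_color Q y.1 ->
    kind_size sh x <> Some 0 -> kind_size sh y <> Some 0 ->
    kind_le x y <-> (f x <= f y)%R }.

(** This is the hypothesis on fibres in [matching_extend]: small kinds keep their size on both
    sides, and merged ones have at least [Q] elements. *)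
Lemma truncation_fibre A Q (sh0 : color A -> bool * option nat)
    U (k : U -> kind A) sh f U' (k' : U' -> kind A) sh' f' :
  truncation Q sh0 k sh f -> truncation Q sh0 k' sh' f' -> forall u,
  [set v | truncate_kind Q f (k v) = truncate_kind Q f (k u)] #=
    [set v | truncate_kind Q f' (k' v) = truncate_kind Q f (k u)] \/
  `I_Q #<= [set v | truncate_kind Q f' (k' v) = truncate_kind Q f (k u)].
Proof.
move=> tr tr' u; have [lu|nlu] := boolP (large_color Q (k u).1).
  right; have [x [lx fx Qx]] := trunc_onto tr' (f (k u)).
  apply: card_le_trans Qx _; rewrite -(card_le_eql (trunc_size tr' x)).
  by apply: subset_card_le => v /= ->; rewrite /truncate_kind lx lu fx.
left.
have small V (g : V -> kind A) h :
    [set v | truncate_kind Q h (g v) = truncate_kind Q f (k u)] = [set v | g v = k u].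
  rewrite {2}/truncate_kind (negbTE nlu); apply/seteqP; split=> v /=; last first.
    by move=> e; rewrite /truncate_kind e (negbTE nlu).
  by rewrite /truncate_kind; case: ifP => // _ e; rewrite -e in nlu.
rewrite !small (card_eql (trunc_size tr _)) (card_eqr (trunc_size tr' _)).
by rewrite /kind_size (trunc_small tr) // (trunc_small tr').
Qed.

(** The small ordered colors that are realized are the [cF m] with [m < Q], and they lie below all
    large ones. *)
Lemma truncation_le A Q (sh0 : color A -> bool * option nat)
    U (k : U -> kind A) sh f : truncation Q sh0 k sh f -> forall u v,
  kind_le (k u) (k v) <-> kind_le (truncate_kind Q f (k u)) (truncate_kind Q f (k v)).
Proof.
move=> tr u v.
have nz w : kind_size sh (k w) <> Some 0.
  by apply/(size_set_eq0 (trunc_size tr (k w))); exists w.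
have nL w : (k w).1 <> cL.
  move=> e; apply: (nz w); rewrite /kind_size e (trunc_small tr) // (trunc_least tr) /=.
  by case: ifP.
rewrite /truncate_kind; case: ifPn => lu; case: ifPn => lv //.
- rewrite [X in _ <-> X]kind_le_same //=; exact: (trunc_le tr).
- have nuv : (k u).1 <> (k v).1 by move=> e; move: lv; rewrite -e lu.
  rewrite kind_le_diff // kind_le_diff /= => [|e]; last by rewrite -e in lv.
  move: lu lv (nL u) (nL v).
  case: (k u).1 => [a||n||] //; case: (k v).1 => [b||m||] //= Qn.
  rewrite -ltnNge => mQ _ _; split=> // nm.
  by have := leq_trans mQ (leq_trans Qn (ltnW nm)); rewrite ltnn.
- have nuv : (k u).1 <> (k v).1 by move=> e; move: lu; rewrite e lv.
  rewrite kind_le_diff // kind_le_diff /= => [|e]; last by rewrite e in lu.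
  move: lu lv (nL u) (nL v).
  case: (k u).1 => [a||n||] //; case: (k v).1 => [b||m||] //=.
  by rewrite -ltnNge => nQ Qm _ _; split=> // _; exact: leq_trans nQ Qm.
Qed.

Lemma truncate_kind_rigid A Q (f : kind A -> rat) x a :
  (truncate_kind Q f x).1 = cD a <-> x.1 = cD a.
Proof.
rewrite /truncate_kind; case: ifP => // lx; split=> // e; by rewrite e in lx.
Qed.

Section Nonstandard.
Variables (L : signature) (A : Type) (M : structure L A) (D : set A) (ord : option L).
Arguments M : clear implicits.
Hypothesis frM : framed M D ord.
Variable J : A -> option L.
Hypothesis JP : forall a b, orel1 M (J a) b <-> b = a /\ D a.
Variables (oD : option L) (sR : option nat) (k : A -> kind A).
Hypothesis oDP : forall a, orel1 M oD a <-> D a.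
Hypothesis sRP : sR = None \/ sR = Some 0.
Notation sh0 := (shape D sR (Some (false, false))).
Notation sh1 := (shape D sR (Some (false, true))).
Hypothesis kP : presents ord J M sh0 k.

Lemma base_ordered u : orel2 M ord u u <-> exists n, (k u).1 = cF n.
Proof.
have [_ _ ->] := kP; rewrite kind_le_refl; split=> [|[n ->]//].
have := presents_size (u := u) kP; rewrite /kind_size.
by case: (k u).1 => [a||n||] //=; rewrite ?if_same // => _ _; exists n.
Qed.

Lemma base_onto n r : exists u, k u = (cF n, r).
Proof. exact: (presents_onto kP). Qed.

Lemma base_class u n : (k u).1 = cF n ->
  [set v | orel2 M ord u v /\ orel2 M ord v u] #= `I_n.+1.
Proof.
have [ksz _ kle] := kP => ku.
have := ksz (k u); rewrite /kind_size ku /=.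
rewrite (_ : [set v | k v = _] = [set v | orel2 M ord u v /\ orel2 M ord v u]) //.
apply/seteqP; split=> v /=; rewrite !kle.
  by move=> ->; rewrite kind_le_refl ku.
by move=> [uv vu]; exact: kind_le_anti.
Qed.

Lemma base_class_gt u n m : (k u).1 = cF n -> class_gt ord m M u <-> (m <= n)%N.
Proof.
move=> ku; have uu : orel2 M ord u u by apply/base_ordered; exists n.
have cu := (@card_eqS_rem _ _ u n (conj uu uu)).1 (base_class ku).
rewrite /class_gt (_ : [set v | _] =
  [set v | [set v | orel2 M ord u v /\ orel2 M ord v u] v /\ v <> u]).
  by rewrite (card_le_eqr cu) card_le_II.
by apply/seteqP; split=> v /=; [move=> [? []]|move=> [[]]].
Qed.

Lemma base_graded : graded_preorder ord M.
Proof.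
have [_ _ kle] := kP.
have dense : dense_preorder [set x : kind A | exists n, x.1 = cF n] (@kind_le A).
  apply: (dense_preorder_kind (C := fun c => exists n, c = cF n)).
    by exists (cF 0); exists 0%N.
  by move=> c [n ->].
have lt u n q : (k u).1 = cF n -> ((k u).2 < q)%R -> exists2 v, (k v).1 = cF n &
    orel2 M ord u v /\ ~ orel2 M ord v u.
  move=> ku uq; have [v kv] := base_onto n q; exists v; first by rewrite kv.
  rewrite !kle !kind_le_same ?kv ?ku //=; split; first exact: ltW.
  by rewrite leNgt uq.
have gt u n q : (k u).1 = cF n -> (q < (k u).2)%R -> exists2 v, (k v).1 = cF n &
    orel2 M ord v u /\ ~ orel2 M ord u v.
  move=> ku uq; have [v kv] := base_onto n q; exists v; first by rewrite kv.
  rewrite !kle !kind_le_same ?kv ?ku //=; split; first exact: ltW.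
  by rewrite leNgt uq.
have field u v : orel2 M ord u v -> orel2 M ord u u /\ orel2 M ord v v.
  by rewrite !kle !kind_le_refl => /kind_le_ordered.
split => //.
- by move=> u v w; rewrite !kle; exact: kind_le_trans.
- by move=> u v; rewrite !kle !kind_le_refl; exact: kind_le_total.
- move=> u v uv vu; have [/base_ordered un /base_ordered vn] := field _ _ uv.
  rewrite kle in vu; have [x [[n xn] xu vx]] := dense_dense dense un vn vu.
  have [w kw] := base_onto n x.2.
  have kwx : k w = x by rewrite kw -xn; case: (x).
  have wo : color_ordered (k w).1 by rewrite kw.
  have [[nu ku] [nv kv]] := (un, vn).
  exists w; rewrite !kle kwx; do !split => //.
    by case: (@kind_le_total _ (k u) x) => //; rewrite -?kwx // ku.
  by case: (@kind_le_total _ x (k v)) => //; rewrite -?kwx // kv.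
- move=> u /base_ordered[n ku].
  by have [|v _ uv] := lt u n ((k u).2 + 1)%R ku; [rewrite ltrDl|exists v].
- move=> n u v uv; have [/base_ordered[nu ku] /base_ordered[nv kv]] := field _ _ uv.
  rewrite (base_class_gt _ ku) (base_class_gt _ kv) => nnu; apply: leq_trans nnu _.
  by move: uv; rewrite kle /kind_le ku kv => -[/ltnW//|[_ [->]]].
- move=> n; have [u ku] := base_onto n 0%R; have {}ku : (k u).1 = cF n by rewrite ku.
  exists u; rewrite !(base_class_gt _ ku) leqnn ltnn; split=> //.
  by apply/base_ordered; exists n.
- move=> n u /base_ordered[m ku]; rewrite !(base_class_gt _ ku) => nm _.
  have [|v kv [vu uv]] := gt u m ((k u).2 - 1)%R ku; first by rewrite ltrBlDr ltrDl.
  by exists v; rewrite (base_class_gt _ kv).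
- move=> n u /base_ordered[m ku]; rewrite !(base_class_gt _ ku) => _ nm.
  have [|v kv [vu uv]] := lt u m ((k u).2 + 1)%R ku; first by rewrite ltrDl.
  by exists v; rewrite (base_class_gt _ kv).
Qed.

(** The shape [sh1] is realized literally, each kind being repeated as often as its size prescribes.
    It has infinite classes, and none of them is least. *)
Definition nonstandard : Type :=
  {x : kind A * nat | size_set (kind_size sh1 x.1) x.2}.

Definition nonstandard_kind (w : nonstandard) : kind A := (proj1_sig w).1.

Definition nonstandard_struct : structure L nonstandard := fun s v =>
  match pselect (ord = Some s) with
  | left so => kind_le
      (nonstandard_kind (v (cast_ord (esym (framed_arity frM so)) ord0)))
      (nonstandard_kind (v (cast_ord (esym (framed_arity frM so)) ord_max)))
  | right _ => exists2 a, M s a & forall i, (nonstandard_kind (v i)).1 = cD (a i)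
  end.

Lemma nonstandard_size x :
  [set w | nonstandard_kind w = x] #= size_set (kind_size sh1 x).
Proof.
apply: (@card_eq_of_bij _ _ _ _ (fun w : nonstandard => (proj1_sig w).2)).
- by move=> [[y i] yi] /= <-.
- move=> [[y i] yi] [[z j] zj] /= ey ez eij.
  rewrite /nonstandard_kind /= in ey ez; subst.
  by rewrite (Prop_irrelevance yi zj).
- by move=> i xi; exists (exist _ (x, i) xi).
Qed.

Lemma nonstandard_le u v : ord <> None ->
  orel2 nonstandard_struct ord u v <-> kind_le (nonstandard_kind u) (nonstandard_kind v).
Proof.
move=> oN; have [s so] : exists s, ord = Some s by case: ord oN => // s; exists s.
by rewrite so /= /nonstandard_struct; case: pselect.
Qed.

Lemma ord_neq_None : ord <> None.
Proof. by have [u [+ _]] := graded_ex base_graded 0; case: ord. Qed.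

Lemma nonstandard_equiv : theory M `<=` theory nonstandard_struct.
Proof.
move=> p Mp w0; pose Q := quantifier_rank p.
have [ksz kJ kle] := kP.
have cK : countable [set: kind A].
  by apply: countable_kind; rewrite /countable (card_le_eql (framed_countable frM)).
(* In [M] the color [cI] is not realized, so the merged region consists of the finite classes of
   more than [Q] elements only; in the other structure ([dW]) it includes the infinite ones. Both
   are copies of [rat]. *)
have dM : dense_preorder [set x : kind A |
    large_color Q x.1 && (if x.1 is cI then false else true)] (@kind_le A).
  apply: (dense_preorder_kind
    (C := fun c => large_color Q c && (if c is cI then false else true))); last by case.
  by exists (cF Q); rewrite /= leqnn.
have dW : dense_preorder [set x : kind A | large_color Q x.1] (@kind_le A).
  by apply: (dense_preorder_kind (C := @large_color A Q)); [exists cI|case].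
have [f [fle fonto]] := cantor_rat cK dM.
have [g [gle gonto]] := cantor_rat cK dW.
have trM : truncation Q sh0 k sh0 f.
  split=> //.
    move=> r; have [x /andP[lx xI] fx] := fonto r; exists x; split=> //.
    by case: x lx xI {fx} => -[a||n||] //= q Qn _; rewrite /kind_size /= card_le_II (leq_trans Qn).
  move=> x y lx ly sx sy; apply: fle; rewrite /= ?lx ?ly /=.
    by case: x lx sx => -[] //= q _; rewrite /kind_size /= if_same.
  by case: y ly sy => -[] //= q _; rewrite /kind_size /= if_same.
have trW : truncation Q sh0 nonstandard_kind sh1 g.
  split=> //; first exact: nonstandard_size.
  - by case.
  - move=> r; have [x lx gx] := gonto r; exists x; split=> //.
    case: x lx {gx} => -[a||n||] //= q Qn; rewrite /kind_size /= ?card_leT //.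
    by rewrite card_le_II (leq_trans Qn).
  - by move=> x y lx ly _ _; exact: gle.
pose K0 := truncate_kind Q f \o k.
pose K1 := truncate_kind Q g \o nonstandard_kind.
(* With [n] points chosen and [q] rounds left, [n + q <= Q] ensures [n < Q] at every move, as
   [matching_extend] requires. *)
pose I q n (v : 'I_n -> A) (w : 'I_n -> nonstandard) :=
  (n + q <= Q)%N /\ matching K0 K1 v w.
have v0 : 'I_0 -> A by case.
apply/(@back_and_forth_satisfies _ _ _ M nonstandard_struct I _ _ _ _ _ p Q v0 w0 _ _).1.
- by move=> q n v w [_ []].
- move=> q n v w [_ [kvw _]] s u.
  have {}kvw i : truncate_kind Q f (k (v i)) = truncate_kind Q g (nonstandard_kind (w i)).
    exact: kvw.
  rewrite /nonstandard_struct; case: pselect => [so|so].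
    rewrite (orel2E _ (framed_arity frM so)) -so kle (truncation_le trM) (truncation_le trW).
    by rewrite /= !kvw.
  have rigid i a : (k (v i)).1 = cD a <-> (nonstandard_kind (w i)).1 = cD a.
    rewrite -(truncate_kind_rigid Q f) -(truncate_kind_rigid Q g (nonstandard_kind _)).
    by rewrite kvw.
  split=> [Mv|[a Ma ka]].
    exists (v \o u) => // i; apply/rigid/kJ/JP; split=> //.
    exact: (framed_support frM so Mv).
  suff <- : a = v \o u by [].
  by apply/funext => i; have /rigid/kJ/JP[] := ka i.
- move=> q n v w [nq mvw] a.
  have nQ : (n < Q)%N by apply: leq_trans nq; rewrite addnS ltnS leq_addr.
  have [b mb] := matching_extend (truncation_fibre trM trW a) nQ mvw.
  by exists b; split=> //; rewrite addSnnS.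
- move=> q n v w [nq mvw] b.
  have nQ : (n < Q)%N by apply: leq_trans nq; rewrite addnS ltnS leq_addr.
  have [a ma] := matching_extend (truncation_fibre trW trM b) nQ (matching_sym mvw).
  by exists a; split; [rewrite addSnnS|exact: matching_sym].
- exact: leqnn.
- by split=> //; split; case.
- exact: Mp.
Qed.

Lemma nonstandard_countable : countable [set: nonstandard].
Proof.
apply: (@sub_countable _ _ _ [set: kind A * nat]).
  apply: (@card_le_of_inj _ _ _ _ (fun w : nonstandard => proj1_sig w)) => //.
  by move=> [x px] [y py] _ _ /= e; subst; rewrite (Prop_irrelevance px py).
apply: countable_kind_nat; by rewrite /countable (card_le_eql (framed_countable frM)).
Qed.

(** The points of kind [(cI, 0)] form an infinite class, while all classes of [M] are finite. *)
Lemma nonstandard_not_isomorphic : ~ isomorphic M nonstandard_struct.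
Proof.
move=> [f [[g fK gK] fP]].
have fle u v : orel2 M ord u v <-> kind_le (nonstandard_kind (f u)) (nonstandard_kind (f v)).
  rewrite -(nonstandard_le _ _ ord_neq_None) /orel2; case: ord => // s.
  rewrite fP (_ : f \o _ = fun i : 'I_(arity s) => if val i == 0%N then f u else f v) //.
  by apply/funext => i /=; case: ifP.
pose w i : nonstandard := exist _ ((cI, 0%R), i) I.
have gw i : orel2 M ord (g (w i)) (g (w i)) by rewrite fle gK; apply/kind_le_refl.
have /base_ordered[n kn] := gw 0.
have : [set: nat] #<= `I_n.+1.
  rewrite -(card_le_eqr (base_class kn)).
  apply: (@card_le_of_inj _ _ _ _ (fun i => g (w i))) => [i _|i j _ _].
    by rewrite /= !fle !gK; split; apply/kind_le_refl.
  by move=> /(can_inj gK) [].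
by move=> /(infiniteP _).2; apply; exact: finite_II.
Qed.

Lemma J_not_ordered U (N : structure L U) : theory M `<=` theory N ->
  forall a u, orel1 N (J a) u -> ~ orel2 N ord u u.
Proof.
move=> MN a; apply: (definable_transfer MN (P := fun U N => forall u : U,
  orel1 N (J a) u -> ~ orel2 N ord u u)); first by definable_tac.
by have [_ kJ kle] := kP; move=> u /kJ ku; rewrite kle kind_le_refl ku.
Qed.

Lemma graded_Ehrenfeucht : Ehrenfeucht M.
Proof.
have cA : countable [set: A] by rewrite /countable (card_le_eql (framed_countable frM)).
have inhA : inhabited A by have [u _] := base_onto 0 0%R.
pose T (i : 'I_3) := nth (false, false) [:: (false, false); (false, true); (true, true)] i.
pose tp (N : countable_model (theory M)) i :=
  exists k, presents ord J N (shape D sR (Some (T i))) k.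
apply: (@Ehrenfeucht_of_types _ _ _ 3 tp).
- move=> N; have MN := @struct_models _ _ N; have cN := universe_countable N.
  have RN := model_pure_part sRP MN cN (presents_pure_part JP oDP kP).
  have grN := graded_preorder_transfer MN base_graded.
  have [t [tT kN]] := classify_graded frM JP oDP MN cN RN (J_not_ordered MN) grN.
  case: tT => [|[|]] et; rewrite et in kN.
  + by exists ord0.
  + by exists (@Ordinal 3 1 isT).
  + by exists (@Ordinal 3 2 isT).
- by move=> N N' i [kN PN] [kN' PN']; exact: (presents_isomorphic frM JP PN PN').
- exists (@CountableModel _ (theory M) _ M inhA cA (@subset_refl _ _)).
  have inhW : inhabited nonstandard by split; exists ((cI, 0%R), 0).
  by exists (CountableModel inhW nonstandard_countable nonstandard_equiv);
    exact: nonstandard_not_isomorphic.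
Qed.
End Nonstandard.

Lemma framed_J (L : signature) A (M : structure L A) D ord : framed M D ord ->
  exists J : A -> option L, forall a b, orel1 M (J a) b <-> b = a /\ D a.
Proof.
move=> frM.
have /choice[J JP] : forall a, exists s, forall b, orel1 M s b <-> b = a /\ D a.
  by move=> a; apply: (framed_unary frM (X := [set b | b = a /\ D a])) => b [-> ].
by exists J.
Qed.

Lemma framed_not_Ehrenfeucht (L : signature) A (M : structure L A) D :
  framed M D None -> (infinite_set (~` D) \/ D = setT) -> ~ Ehrenfeucht M.
Proof.
move=> frM DC; have [J JP] := framed_J frM.
have [oD oDP] := framed_unary frM (@subset_refl _ D).
have [sR sRP RM] : exists2 sR, sR = None \/ sR = Some 0 &
    [set u | ~ orel1 M oD u /\ ~ orel2 M None u u] #= size_set sR.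
  rewrite (_ : [set u | _] = ~` D); last first.
    by apply/seteqP; split=> [u [/= + _]|u /= Du]; rewrite oDP //; split.
  case: DC => [inf|->].
    exists None; first by left.
    apply: eq_card_nat => //.
    apply: (@sub_countable _ _ _ [set: A]); first exact: card_leT.
    by rewrite /countable (card_le_eql (framed_countable frM)).
  by exists (Some 0); [right|rewrite setCT /= II0].
apply: not_Ehrenfeucht_categorical.
have cl (N : countable_model (theory M)) :
    exists k, presents None J N (shape D sR None) k.
  have MN := @struct_models _ _ N; have cN := universe_countable N.
  by apply: (classify_rigid frM JP oDP MN cN (model_pure_part sRP MN cN RM))
    => [a u _ []|u v []].
move=> N N'; have [[kN PN] [kN' PN']] := (cl N, cl N').
exact: (presents_isomorphic frM JP PN PN').
Qed.

(** * Ehrenfeucht preorders *)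

Definition lex_le (x y : nat * rat) : Prop := (x.1 < y.1)%N \/ x.1 = y.1 /\ (x.2 <= y.2)%R.

(** The triples [(n, r, i)] with [i <= n] form a countably infinite set; transport them to [P] and
    forget [i]. *)
Lemma graded_labelling_exists A (P : set A) : countable [set: A] -> infinite_set P ->
  exists g : A -> nat * rat, forall x, [set a | P a /\ g a = x] #= `I_x.1.+1.
Proof.
move=> cA Pinf.
have PB : P #= [set x : nat * rat * nat | (x.2 <= x.1.1)%N].
  rewrite (card_eql (eq_card_nat _ Pinf)); last by apply: sub_countable cA; exact: card_leT.
  rewrite card_eq_sym; apply: eq_card_nat; first exact: countableP.
  apply/infiniteP.
  by apply: (@card_le_of_inj _ _ _ _ (fun n => ((n, 0%R), 0%N))) => // n m _ _ [].
have [h [hB hinj hsurj]] := card_eq_ex_bij (inhabits ((0%N, 0%R), 0%N)) PB.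
exists (fun a => (h a).1) => x.
apply: (@card_eq_of_bij _ _ _ _ (fun a => (h a).2)).
- by move=> a [Pa <-] /=; rewrite ltnS; exact: hB.
- move=> a b [Pa ax] [Pb bx] ab; apply: hinj => //.
  by rewrite (surjective_pairing (h a)) (surjective_pairing (h b)) ax bx ab.
- move=> i /= ix; have [|a Pa ha] := hsurj (x, i); first by rewrite /= -ltnS.
  by exists a; rewrite ha.
Qed.

Lemma graded_labelling_Ehrenfeucht (L : signature) A (M : structure L A) D s P
    (g : A -> nat * rat) :
  framed M D (Some s) -> (forall x, [set a | P a /\ g a = x] #= `I_x.1.+1) ->
  (forall a, P a -> ~ D a) -> infinite_set (~` (D `|` P)) ->
  (forall a b, orel2 M (Some s) a b <-> [/\ P a, P b & lex_le (g a) (g b)]) ->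
  Ehrenfeucht M.
Proof.
move=> frM gP PD Rinf sle; have [J JP] := framed_J frM.
have [oD oDP] := framed_unary frM (@subset_refl _ D).
pose k a : kind A := if pselect (D a) then (cD a, 0%R)
  else if pselect (P a) then (cF (g a).1, (g a).2) else (cR, 0%R).
apply: (@graded_Ehrenfeucht _ _ _ _ _ frM _ JP oD None k oDP (or_introl erefl)).
have kD a : D a -> k a = (cD a, 0%R) by rewrite /k; case: pselect.
have kR a : ~ D a -> ~ P a -> k a = (cR, 0%R).
  by rewrite /k; case: pselect => // nDa; case: pselect.
have kF a : P a -> k a = (cF (g a).1, (g a).2).
  by move=> Pa; rewrite /k; case: pselect => [Da|nDa]; [case: (PD _ Pa)|case: pselect].
have cases a : [\/ D a /\ k a = (cD a, 0%R), P a /\ k a = (cF (g a).1, (g a).2) |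
    [/\ ~ D a, ~ P a & k a = (cR, 0%R)]].
  have [Da|nDa] := pselect (D a); first by constructor 1; split=> //; exact: kD.
  have [Pa|nPa] := pselect (P a); first by constructor 2; split=> //; exact: kF.
  by constructor 3; split=> //; exact: kR.
have empty x : (forall a, k a <> x) -> [set a | k a = x] #= `I_0.
  by move=> nx; rewrite II0 card_eq0; apply/eqP; rewrite -subset0 => a /nx.
split.
- move=> [c r]; rewrite /kind_size; case: c => [a||n||] /=.
  + case: asboolP => [Da|nDa]; last first.
      rewrite if_same; apply: empty => b; case: (cases b) => [[Db ->]|[Pb ->]|[nD nP ->]] //.
      by move=> [ba]; rewrite -ba in nDa.
    case: eqVneq => [->|r0] /=.
      rewrite (_ : [set u | _] = [set a]); first exact: card_set1.
      apply/seteqP; split=> b /=; last by move=> ->; exact: kD.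
      by case: (cases b) => [[Db ->]|[Pb ->]|[nD nP ->]] // [].
    apply: empty => b; case: (cases b) => [[Db ->]|[Pb ->]|[nD nP ->]] // [_ e].
    by rewrite -e eqxx in r0.
  + case: eqVneq => [->|r0] /=.
      apply: eq_card_nat.
        apply: (@sub_countable _ _ _ [set: A]); first exact: card_leT.
        by rewrite /countable (card_le_eql (framed_countable frM)).
      rewrite (_ : [set u | _] = ~` (D `|` P)) //.
      apply/seteqP; split=> b /=; last by move=> /not_orP[nD nP]; exact: kR.
      by case: (cases b) => [[Db ->]|[Pb ->]|[nD nP _] _ []].
    apply: empty => b; case: (cases b) => [[Db ->]|[Pb ->]|[nD nP ->]] // [e].
    by rewrite -e eqxx in r0.
  + rewrite (_ : [set u | _] = [set a | P a /\ g a = (n, r)]); first exact: gP.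
    apply/seteqP; split=> b /=; last by move=> [/kF -> ->].
    case: (cases b) => [[Db ->]|[Pb ->] [<- <-]|[nD nP ->]] //.
    by rewrite -surjective_pairing.
  + rewrite if_same; apply: empty => b.
    by case: (cases b) => [[Db ->]|[Pb ->]|[nD nP ->]].
  + rewrite if_same; apply: empty => b.
    by case: (cases b) => [[Db ->]|[Pb ->]|[nD nP ->]].
- move=> a b; rewrite JP; split=> [[-> /kD ->//]|].
  by case: (cases b) => [[Db ->] [<-]|[Pb ->]|[nD nP ->]].
- move=> a b; rewrite sle; split=> [[Pa Pb]|].
    rewrite (kF _ Pa) (kF _ Pb) => -[h|[h1 h2]]; first by left.
    by right; split=> //=; rewrite h1.
  have ordP c : color_ordered (k c).1 -> P c.
    by case: (cases c) => [[_ ->]|[]|[_ _ ->]].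
  move=> h; have [/ordP Pa /ordP Pb] := kind_le_ordered h.
  split=> //; move: h; rewrite (kF _ Pa) (kF _ Pb) => -[/= h|[_ /= [h1] h2]].
    by left.
  by right.
Qed.

(** * Restrictions of the maximal expansion *)

Definition supported A (D : set A) (Q : relation A) : Prop :=
  forall v, projT2 Q v -> forall i, D (v i).

Section Restrictions.
Variables (A : Type) (L : signature) (M : structure L A).
Arguments M : clear implicits.
Hypothesis A_nat : [set: A] #= [set: nat].
Hypothesis sym_ex : forall Q : relation A, exists s : L, interp M s = Q.

(** For empty [D] the required unary and binary relations are empty and represented by [None]. No
    symbol is then demanded of [S], so the empty signature and the singletons are covered. *)
Lemma framed_restriction (S : set L) (D : set A) (ord : option (subsignature S)) :
  D = set0 \/ infinite_set D ->
  (D !=set0 -> forall s, supported D (interp M s) -> S s) ->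
  (forall s (Ss : S s), ord <> Some (exist _ s Ss) -> supported D (interp M s)) ->
  (forall s, ord = Some s -> arity s = 2) ->
  framed (restriction M S) D ord.
Proof.
move=> Dinf full supp ar2; split=> //.
- move=> X XD; have [D0|nD] := pselect (D !=set0); last first.
    by exists None => a; split=> // /XD Da; apply: nD; exists a.
  have [s sX] := sym_ex (existT (fun n => set ('I_n -> A)) 1 [set v | X (v ord0)]).
  have Ss : S s by apply: full => //; rewrite sX => v /= /XD Dv i; rewrite ord1.
  exists (Some (exist _ s Ss)) => a /=.
  by rewrite -[restriction M S _ _]/(projT2 (interp M s) (fun=> a)) sX.
- move=> X XD; have [D0|nD] := pselect (D !=set0); last first.
    by exists None => a b; split=> // /XD[Da _]; apply: nD; exists a.
  have [s sX] :=
    sym_ex (existT (fun n => set ('I_n -> A)) 2 [set v | X (v ord0) (v ord_max)]).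
  have Ss : S s.
    apply: full => //; rewrite sX => v /= /XD[D1 D2] i.
    case: (unliftP ord0 i) => [j|] -> //; rewrite (_ : lift ord0 j = ord_max) //.
    by apply: val_inj; rewrite /= ord1.
  exists (Some (exist _ s Ss)) => a b /=.
  by rewrite -[restriction M S _ _]/(projT2 (interp M s)
    (fun i => if val i == 0%N then a else b)) sX.
- move=> [s Ss] so v sv i; exact: (supp s Ss so v sv i).
Qed.
End Restrictions.

(** * Renaming of symbols *)

(** A permuted structure has another signature, so formulas must be translated along [m]. Since [m]
    is a relation, its converse serves as the inverse translation; arities agree only
    propositionally, whence the cast. *)
Definition transported (L1 L2 : signature) (m : L1 -> L2 -> Prop) U V
    (X : structure L1 U) (Y : structure L2 V) (f : U -> V) : Prop :=
  forall s t (e : arity t = arity s), m s t ->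
  forall v, X s v <-> Y t (f \o v \o cast_ord e).

Record renaming (L1 L2 : signature) (m : L1 -> L2 -> Prop) : Prop := {
  renaming_arity : forall s t, m s t -> arity t = arity s;
  renaming_total : forall s, exists t, m s t;
  renaming_inj : forall s s' t, m s t -> m s' t -> s = s' }.

Lemma comp_cast_ordK (U : Type) n n' (e : n = n') (e' : n' = n) (v : 'I_n' -> U) :
  v \o cast_ord e \o cast_ord e' = v.
Proof. by apply/funext => i /=; congr v; exact: val_inj. Qed.

Lemma transported_sym (L1 L2 : signature) (m : L1 -> L2 -> Prop) U V
    (X : structure L1 U) (Y : structure L2 V) f g :
  cancel g f -> transported m X Y f -> transported (fun t s => m s t) Y X g.
Proof.
move=> gK XY t s e mst v; rewrite (XY s t (esym e) mst).
rewrite (_ : f \o _ \o _ = f \o g \o (v \o cast_ord e \o cast_ord (esym e))) //.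
by rewrite comp_cast_ordK (_ : f \o g \o v = v) //; apply/funext => i /=.
Qed.

Lemma transported_ex (L1 L2 : signature) (m : L1 -> L2 -> Prop) U (X : structure L1 U) :
  renaming m -> exists Y : structure L2 U, transported m X Y id.
Proof.
move=> mP; exists (fun t v => exists s (e : arity s = arity t),
  m s t /\ X s (v \o cast_ord e)) => s t e mst v.
split=> [Xv|[s' [e' [ms't]]]].
  exists s, (esym e); split=> //.
  by rewrite (_ : id \o v \o cast_ord e \o _ = v) //; exact: comp_cast_ordK.
move: e'; rewrite -(renaming_inj mP mst ms't) => e'.
by rewrite (_ : id \o v \o cast_ord e \o _ = v) //; exact: comp_cast_ordK.
Qed.

(** The translation depends on [m] alone, so one [p'] serves a structure and all models of its
    theory. *)
Lemma transported_satisfies (L1 L2 : signature) (m : L1 -> L2 -> Prop) n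
    (p : formula L1 n) : renaming m ->
  exists p' : formula L2 n, forall U V (X : structure L1 U) (Y : structure L2 V) f,
    bijective f -> transported m X Y f ->
    forall v, satisfies X p v <-> satisfies Y p' (f \o v).
Proof.
move=> mP; elim: p => {n} [n|n i j|n s w|n p [p' IHp] q [q' IHq]|n p [p' IHp]].
- by exists (Fbot L2 n).
- exists (Feq L2 i j) => U V X Y f /bij_inj finj _ v /=.
  by split=> [->//|/finj].
- have [t mst] := renaming_total mP s.
  exists (Frel (w \o cast_ord (renaming_arity mP mst))) => U V X Y f _ XY v /=.
  exact: XY.
- exists (Fimp p' q') => U V X Y f fb XY v /=.
  by rewrite (IHp U V X Y f) // (IHq U V X Y f).
- exists (Fall p') => U V X Y f fb XY v /=.
  have ext a : extend (f a) (f \o v) = f \o extend a v.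
    by apply/funext => i; case: (unliftP ord0 i) => [j|] -> /=; rewrite ?extendS ?extend0.
  have [g fK gK] := fb; split=> h a.
    by rewrite -(gK a) ext; apply/(IHp U V X Y f).
  by apply/(IHp U V X Y f) => //; rewrite -ext.
Qed.

Lemma transported_theory (L1 L2 : signature) (m : L1 -> L2 -> Prop) A B U V
    (M1 : structure L1 A) (M2 : structure L2 B) f
    (N1 : structure L1 U) (N2 : structure L2 V) g : renaming m ->
  bijective f -> bijective g -> transported m M1 M2 f -> transported m N1 N2 g ->
  theory M2 `<=` theory N2 -> theory M1 `<=` theory N1.
Proof.
move=> mP fb gb M12 N12 MN p Mp v; have [p' pP] := transported_satisfies p mP.
apply/(pP _ _ _ _ _ gb N12); apply: (MN p') => w.
have v0 : 'I_0 -> A by case.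
by rewrite (fun_ord0 w (f \o v0)); apply/(pP _ _ _ _ _ fb M12); exact: Mp.
Qed.

Lemma transported_isomorphic (L1 L2 : signature) (m : L1 -> L2 -> Prop) U V U' V'
    (X : structure L1 U) (Y : structure L2 V) h
    (X' : structure L1 U') (Y' : structure L2 V') h' : renaming (fun t s => m s t) ->
  bijective h -> bijective h' -> transported m X Y h -> transported m X' Y' h' ->
  isomorphic X X' -> isomorphic Y Y'.
Proof.
move=> mP hb h'b XY XY' [f [fb fP]].
have [g hK gK] := hb.
exists (h' \o f \o g); split.
  by apply: bij_comp; [apply: bij_comp|exists h].
move=> t v; have [s mst] := renaming_total mP t.
have e := esym (renaming_arity mP mst).
rewrite (transported_sym gK XY (esym e) mst v) fP (XY' s t e mst).
by rewrite (_ : h' \o _ \o _ = (h' \o f \o g) \o (v \o cast_ord (esym e) \o cast_ord e))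
  // comp_cast_ordK.
Qed.

(** Reinterpreting the symbols on the same universe turns countable models of either theory into
    countable models of the other, and isomorphisms are preserved both ways. *)
Lemma transported_Ehrenfeucht (L1 L2 : signature) (m : L1 -> L2 -> Prop) A B
    (M1 : structure L1 A) (M2 : structure L2 B) f :
  renaming m -> renaming (fun t s => m s t) -> bijective f ->
  transported m M1 M2 f -> Ehrenfeucht M1 -> Ehrenfeucht M2.
Proof.
move=> mP mP' fb M12 [n n1 [F [Finj Fcov]]].
pose rel (N1 : countable_model (theory M1)) (N2 : countable_model (theory M2)) :=
  exists2 h : universe N1 -> universe N2, bijective h & transported m N1 N2 h.
have [g fK gK] := fb.
have M21 := transported_sym gK M12.
have gb : bijective g by exists f.
have idb U : bijective (@id U) by exists id.
have up N1 : exists N2, rel N1 N2.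
  have [Y XY] := transported_ex N1 mP.
  have YX := transported_sym (g := id) (fun=> erefl) XY.
  have YM := transported_theory mP' gb (idb _) M21 YX (@struct_models _ _ N1).
  by exists (CountableModel (universe_neq0 N1) (universe_countable N1) YM); exists id.
have down N2 : exists N1, rel N1 N2.
  have [X YX] := transported_ex N2 mP'.
  have XY := transported_sym (g := id) (fun=> erefl) YX.
  have XM := transported_theory mP fb (idb _) M12 XY (@struct_models _ _ N2).
  by exists (CountableModel (universe_neq0 N2) (universe_countable N2) XM); exists id.
have /choice[G GP] := up.
exists n => //; exists (G \o F); split=> [i j GFij|N2].
  apply: Finj; have [h hb hP] := GP (F i); have [h' hb' hP'] := GP (F j).
  have [hi hK hiK] := hb; have [hi' hK' hiK'] := hb'.
  apply: (transported_isomorphic (m := fun t s => m s t) mP _ _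
    (transported_sym hiK hP) (transported_sym hiK' hP') GFij).
    by exists h.
  by exists h'.
have [N1 [h hb hP]] := down N2; have [i N1i] := Fcov N1; exists i.
have [h' hb' hP'] := GP (F i).
exact: (transported_isomorphic mP' hb hb' hP hP' N1i).
Qed.

(** * Invariance under permutations *)

Lemma image_relationK A (f g : A -> A) : cancel f g ->
  cancel (image_relation f) (image_relation g).
Proof.
move=> fK [n Q]; congr existT; apply/seteqP; split=> [_ [_ [v Qv <-] <-]|v Qv] /=.
  by rewrite (_ : g \o (f \o v) = v) //; apply/funext => i /=.
exists (f \o v); first by exists v.
by apply/funext => i /=.
Qed.

Lemma PEhr_closed_under_permutations (L : signature) A (M : structure L A) :
  regular M -> (forall Q : relation A, exists s, interp M s = Q) ->
  closed_under_permutations (PEhr M).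
Proof.
move=> regM sym_ex f fb S; have [g fK gK] := fb.
have sig_eq (T : set L) (s t : subsignature T) : proj1_sig s = proj1_sig t -> s = t.
  by case: s t => [s Ts] [t Tt] /= e; subst; rewrite (Prop_irrelevance Ts Tt).
pose m (s : subsignature S) (t : subsignature (permute f S)) :=
  interp M (proj1_sig t) = image_relation f (interp M (proj1_sig s)).
have mar s t : m s t -> arity t = arity s by move=> /(congr1 (@projT1 _ _)).
apply: (@transported_Ehrenfeucht _ _ m _ _ _ _ f) => //.
- split=> //.
    move=> [s Ss]; have [t tP] := sym_ex (image_relation f (interp M s)).
    have St : permute f S t by exists s.
    by exists (exist _ t St).
  move=> s s' t ms ms'; apply: sig_eq; apply: regM; apply: (can_inj (image_relationK fK)).
  by rewrite -ms -ms'.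
- split.
  + by move=> t s /mar.
  + by move=> [t [s Ss tP]]; exists (exist _ s Ss).
  + by move=> t t' s ms ms'; apply: sig_eq; apply: regM; rewrite ms ms'.
- move=> s t e mst v.
  (* Stated for arbitrary equal relations, so that the equality can be eliminated although the arity
     occurs in the type of [w]. *)
  have castE (Q R : relation A) (QR : Q = R) (e' : projT1 Q = projT1 R) w :
      projT2 R w <-> projT2 Q (w \o cast_ord e').
    subst; rewrite (_ : w \o _ = w) //.
    by apply/funext => i /=; congr w; exact: val_inj.
  rewrite -[restriction M _ t _]/(projT2 (interp M (proj1_sig t)) (f \o v \o cast_ord e)).
  rewrite -(castE _ _ mst e (f \o v)); split=> [sv|[w sw] /= fwv]; first by exists v.
  suff <- : w = v by [].
  apply/funext => i; apply: (can_inj fK); exact: (congr1 (@^~ i) fwv).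
Qed.

(** * The alternating chain and the atom *)

Section Chain.
Variables (A : Type) (L : signature) (M : structure L A).
Arguments M : clear implicits.
Hypothesis A_nat : [set: A] #= [set: nat].
Hypothesis sym_ex : forall Q : relation A, exists s : L, interp M s = Q.

Definition full_on (D : set A) : BA M := [set s | supported D (interp M s)].

Lemma rigid_not_PEhr (S : BA M) (D : set A) :
  D = set0 \/ infinite_set D -> infinite_set (~` D) \/ D = setT ->
  (D !=set0 -> full_on D `<=` S) -> S `<=` full_on D -> ~ PEhr M S.
Proof.
move=> Dinf DC full supp; apply: (@framed_not_Ehrenfeucht _ _ _ D) => //.
by apply: framed_restriction => // s Ss _; exact: supp.
Qed.

Lemma graded_PEhr (S : BA M) (D P : set A) (g : A -> nat * rat) s :
  D = set0 \/ infinite_set D -> infinite_set (~` (D `|` P)) ->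
  (forall a, P a -> ~ D a) ->
  (forall x, [set a | P a /\ g a = x] #= `I_x.1.+1) ->
  interp M s = existT (fun n => set ('I_n -> A)) 2
    [set v | [/\ P (v ord0), P (v ord_max) & lex_le (g (v ord0)) (g (v ord_max))]] ->
  (D !=set0 -> full_on D `<=` S) -> S s -> (forall t, S t -> t <> s -> full_on D t) ->
  PEhr M S.
Proof.
move=> Dinf Rinf PD gP sP full Ss supp.
pose s' : subsignature S := exist _ s Ss.
apply: (@graded_labelling_Ehrenfeucht _ _ _ D s' P g) => //.
  apply: framed_restriction => //.
    move=> t St ts; apply: supp => // e; apply: ts; subst.
    by congr Some; rewrite /s' (Prop_irrelevance Ss St).
  by move=> _ [<-]; exact: (congr1 (@projT1 _ _) sP).
move=> a b.
by rewrite -[orel2 _ _ _ _]/(projT2 (interp M s) (fun i => if val i == 0%N then a else b)) sP.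
Qed.

Lemma PEhr_chain : exists (N : nat -> BA M) (s : L),
  [/\ forall n, (N n < N n.+1)%O, forall n, PEhr M (N n) <-> odd n & PEhr M [set s]].
Proof.
have cA : countable [set: A] by rewrite /countable (card_le_eql A_nat).
have inh2 : inhabited (nat * nat) by split; exact: (0%N, 0%N).
have [psi [_ psi_inj psi_surj]] := card_eq_ex_bij inh2
  (card_eq_trans A_nat (card_esym card_nat2)).
pose P i := [set a | (psi a).1 = i].
pose D i := [set a | ((psi a).1 < i)%N].
have Pinf i : infinite_set (P i).
  have /choice[h hP] : forall j, exists a, psi a = (i, j).
    by move=> j; have [a _ ?] := psi_surj (i, j) I; exists a.
  apply/infiniteP; apply: (@card_le_of_inj _ _ _ _ h) => [j _|j j' _ _ e].
    by rewrite /P /= hP.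
  by have := hP j; rewrite e hP => -[].
have Dinf i : D i = set0 \/ infinite_set (D i).
  case: i => [|i]; first by left; rewrite -subset0 => a.
  by right; apply: sub_infinite_set (Pinf 0%N) => a; rewrite /P /D /= => ->.
have DCinf i : infinite_set (~` D i).
  by apply: sub_infinite_set (Pinf i) => a; rewrite /P /D /= => ->; rewrite ltnn.
have DPinf i : infinite_set (~` (D i `|` P i)).
  apply: sub_infinite_set (Pinf i.+1) => a; rewrite /P /D /= => ->.
  by rewrite ltnNge leqnSn => -[//|/eqP]; rewrite gtn_eqF.
have PD i a : P i a -> ~ D i a by rewrite /P /D /= => ->; rewrite ltnn.
have /choice[g gP] := fun i => graded_labelling_exists cA (Pinf i).
have /choice[s sP] := fun i => sym_ex (existT (fun n => set ('I_n -> A)) 2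
  [set v | [/\ P i (v ord0), P i (v ord_max) &
               lex_le (g i (v ord0)) (g i (v ord_max))]]).
have s_notin i : ~ full_on (D i) (s i).
  rewrite /full_on /= sP => h; have [a Pa] := infinite_setN0 (Pinf i).
  apply: (PD _ _ Pa); apply: (h (fun=> a) _ ord0) => /=; split=> //.
  by right.
(* This keeps the symbol of the preorder in the signature when its piece becomes rigid. *)
have s_in i : full_on (D i.+1) (s i).
  rewrite /full_on /= sP => v /= [P0 P1 _] l.
  have PSD a : P i a -> D i.+1 a by rewrite /P /D /= => ->.
  case: (unliftP ord0 l) => [j|] ->; last exact: PSD.
  rewrite (_ : lift ord0 j = ord_max); first exact: PSD.
  by apply: val_inj; rewrite /= ord1.
have full_sub i : full_on (D i) `<=` full_on (D i.+1).
  by move=> t h v tv l; rewrite /D /= ltnW // ltnS; exact: h.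
pose N n : BA M := if odd n then full_on (D n./2) `|` [set s n./2] else full_on (D n./2).
have N_even i : N i.*2 = full_on (D i) by rewrite /N odd_double doubleK.
have N_odd i : N i.*2.+1 = full_on (D i) `|` [set s i].
  by rewrite /N /= odd_double /= uphalf_double.
have even_odd n : exists i, n = i.*2 \/ n = i.*2.+1.
  by exists n./2; rewrite -{1 3}(odd_double_half n); case: odd; [right|left].
exists N, (s 0%N); split.
- move=> n; have [i [->|->]] := even_odd n.
    rewrite N_even N_odd lt_def; apply/andP; split; last by apply/subsetPset => t; left.
    apply/eqP => e; apply: (s_notin i); rewrite -e; by right.
  rewrite -doubleS N_even N_odd lt_def; apply/andP; split; last first.
    by apply/subsetPset => t [/full_sub//|->].
  apply/eqP => e.
  (* The unary relation [P i] witnesses strictness: it is not supported on [D i], and its arity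
     distinguishes it from [s i]. *)
  have [t tP] := sym_ex (existT (fun n => set ('I_n -> A)) 1 [set v | P i (v ord0)]).
  have : full_on (D i.+1) t.
    by rewrite /full_on /= tP => v /= Pv l; rewrite ord1 /D /= Pv.
  rewrite e => -[|ts].
    rewrite /full_on /= tP => h; have [a Pa] := infinite_setN0 (Pinf i).
    by apply: (PD _ _ Pa); exact: (h (fun=> a) Pa ord0).
  by have := congr1 (@projT1 _ _) (sP i); rewrite -ts tP.
- move=> n; have [i [->|->]] := even_odd n.
    rewrite N_even odd_double; split=> // h; exfalso; move: h.
    by apply: (@rigid_not_PEhr _ (D i)); [exact: Dinf|left; exact: DCinf|move=> _ t|].
  rewrite N_odd /= odd_double; split=> // _.
  apply: (graded_PEhr (Dinf i) (DPinf i) (PD i) (gP i) (sP i)).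
  + by move=> _ t; left.
  + by right.
  + by move=> t [|->].
(* Since [D 0] is empty, the preorder may be the only relation of the signature. *)
- apply: (graded_PEhr (Dinf 0%N) (DPinf 0%N) (PD 0%N) (gP 0%N) (sP 0%N)) => //.
  by case=> a.
Qed.
End Chain.

Lemma set1_atom (T : Type) (x : T) : atom ([set x] : set T).
Proof.
split=> [/seteqP[/(_ x erefl)]//|Y /subsetPset Yx].
have [Yx'|nYx] := pselect (Y x).
  by right; apply/seteqP; split=> // _ ->.
by left; apply/seteqP; split=> // y Yy; apply: nYx; rewrite -(Yx _ Yy).
Qed.

Theorem theorem6p5 (L : signature) (A : Type) (M : structure L A)
    (A_countably_infinite : [set: A] #= [set: nat])
    (M_regular : regular M)
    (Lbar : signature) (Mbar : structure Lbar A)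
    (Mbar_maximal : maximal_regular_expansion M Mbar) :
  PEhr Mbar !=set0 /\
  ~ PEhr Mbar \bot%O /\
  ~ PEhr Mbar \top%O /\
  closed_under_permutations (PEhr Mbar) /\
  (exists N N' : BA Mbar, PEhr Mbar N /\ (N' <= N)%O /\ ~ PEhr Mbar N') /\
  (exists N N' : BA Mbar, PEhr Mbar N /\ (N <= N')%O /\ ~ PEhr Mbar N') /\
  (exists N : nat -> BA Mbar,
     (forall n : nat, (N n < N n.+1)%O) /\
     (forall n : nat, PEhr Mbar (N n) <-> ~ PEhr Mbar (N n.+1))) /\
  (exists s : Lbar, atom ([set s] : BA Mbar) /\ PEhr Mbar [set s]).
Proof.
have [_ regMbar sym_ex1] := Mbar_maximal.
have sym_ex Q : exists s, interp Mbar s = Q by have [s []] := sym_ex1 Q; exists s.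
have Ainf : infinite_set [set: A].
  by apply/infiniteP; rewrite (card_le_eqr A_countably_infinite).
have nbot : ~ PEhr Mbar \bot%O.
  apply: (rigid_not_PEhr A_countably_infinite sym_ex (D := set0)).
  - by left.
  - by left; rewrite setC0.
  - by case.
  - by [].
have ntop : ~ PEhr Mbar \top%O.
  by apply: (rigid_not_PEhr A_countably_infinite sym_ex (D := setT)) => //; right.
have [N [s [N_lt N_odd sE]]] := PEhr_chain A_countably_infinite sym_ex.
do !split.
- by exists [set s].
- exact: nbot.
- exact: ntop.
- exact: PEhr_closed_under_permutations.
- by exists [set s], \bot%O; split=> //; split=> //; exact: le0x.
- by exists [set s], \top%O; split=> //; split=> //; exact: lex1.
- exists N; split=> // n; rewrite !N_odd /=.
  by case: (odd n); split.
- by exists s; split=> //; exact: set1_atom.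
Qed.
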